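(* Let $\mathbf a\in L^\infty((0,T)\times\mathbb R^N;\mathbb R^N)$ and let $p_1,\dots,p_N\in\mathrm{Lip}_{loc}([0,T]\times\mathbb R^N)$ be real-valued functions with $\partial_tp_i+\mathbf a\cdot\nabla p_i=0$ a.e. in $(0,T)\times\mathbb R^N$ for $i=1,\dots,N$. Then the jacobian determinant $\pi=J(p_1,\dots,p_N)=\det(\nabla p_1,\dots,\nabla p_N)$ belongs to $C([0,T],L^\infty_{loc}(\mathbb R^N)\text{ weak-*})$ and is a weak (distributional) solution of $\partial_t\pi+\operatorname{div}(\mathbf a\pi)=0$ in $(0,T)\times\mathbb R^N$, i.e. $\pi\in\mathcal W^T$.
   Context: $\nabla$ denotes the spatial gradient in $x\in\mathbb R^N$, so $J(p)$ is the spatial Jacobian determinant. $\mathcal W^T$ denotes the set of $\pi\in C([0,T],L^\infty_{loc}(\mathbb R^N)\text{ weak-*})$ which satisfy $\partial_t\pi+\operatorname{div}(\mathbf a\pi)=0$ in the sense of distributions on $(0,T)\times\mathbb R^N$. The set of all such jacobians $J(p)$ is denoted $\mathcal J^T$ (jacobian solutions). *)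

(* Defs.v *)
From HB Require Import structures.
From mathcomp Require Import all_boot all_order all_algebra.
From mathcomp Require Import all_classical all_reals all_analysis.
Set Implicit Arguments. Unset Strict Implicit. Unset Printing Implicit Defensive.
Import Order.TTheory GRing.Theory Num.Theory.
Import numFieldNormedType.Exports.
Local Open Scope classical_set_scope.
Local Open Scope ring_scope.

Section Defs.
Variable R : realType.

(* Points of R^n are row vectors 'rV[R]_n (the norm is the sup norm). *)

(** Iterated Lebesgue integral over R^n (integration coordinate by
    coordinate with the one-dimensional Lebesgue measure).  By
    Tonelli/Fubini this is the n-dimensional Lebesgue integral for
    nonnegative Borel functions and for integrable functions. *)
Fixpoint iint (n : nat) : ('rV[R]_n -> \bar R) -> \bar R :=
  match n return ('rV[R]_n -> \bar R) -> \bar R with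
  | 0 => fun f => f 0
  | n'.+1 => fun f =>
      (\int[@lebesgue_measure R]_x iint (fun v : 'rV[R]_n' =>
                 f (row_mx (x%:M : 'rV[R]_1) v)))%E
  end.

Definition Borel (X : topologicalType) (A : set X) : Prop :=
  <<s [set U : set X | open U] >> A.

Definition Borel_fun (X Y : topologicalType) (f : X -> Y) : Prop :=
  forall B : set Y, open B -> Borel (f @^-1` B).

Definition nullN (n : nat) (A : set 'rV[R]_n) : Prop :=
  exists B : set 'rV[R]_n, [/\ Borel B, A `<=` B &
    iint (fun x => ((\1_B x : R))%:E) = 0%E].

Definition nullTX (n : nat) (A : set (R * 'rV[R]_n)) : Prop :=
  exists B : set (R * 'rV[R]_n), [/\ Borel B, A `<=` B &
    (\int[@lebesgue_measure R]_t
        iint (fun x : 'rV[R]_n => ((\1_B (t, x) : R))%:E))%E = 0%E].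

Definition Lmeas_N (n : nat) (f : 'rV[R]_n -> R) : Prop :=
  exists g : 'rV[R]_n -> R, Borel_fun g /\ nullN [set x | f x <> g x].

Definition Linf_loc (n : nat) (f : 'rV[R]_n -> R) : Prop :=
  Lmeas_N f /\
  forall r : R, exists M : R, nullN [set x | `|x| <= r /\ M < `|f x|].

(** L^1 functions with compact support (the predual of L^infty_loc). *)
Definition L1c (n : nat) (psi : 'rV[R]_n -> R) : Prop :=
  [/\ Lmeas_N psi,
      exists r : R, forall x, r < `|x| -> psi x = 0 &
      (iint (fun x => (`|psi x|)%:E) < +oo)%E].

Definition Cw_Linf_loc (n : nat) (T : R) (pi : R -> 'rV[R]_n -> R) : Prop :=
  (forall t, 0 <= t <= T -> Linf_loc (pi t)) /\
  forall psi, L1c psi ->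
    {within `[0, T], continuous
       (fun t => fine (iint (fun x => (pi t x * psi x)%:E)))}.

Definition Linf_TX (n : nat) (T : R) (a : R -> 'rV[R]_n -> 'rV[R]_n) : Prop :=
  (exists g : R * 'rV[R]_n -> 'rV[R]_n, Borel_fun g /\
     nullTX [set z | 0 < z.1 < T /\ a z.1 z.2 <> g z]) /\
  exists M : R, nullTX [set z | 0 < z.1 < T /\ M < `|a z.1 z.2|].

Definition Lip_loc_TX (n : nat) (T : R) (p : R -> 'rV[R]_n -> R) : Prop :=
  forall r : R, exists L : R, forall t s x y,
    0 <= t <= T -> 0 <= s <= T -> `|x| <= r -> `|y| <= r ->
    `|p t x - p s y| <= L * (`|t - s| + `|x - y|).

Definition ev (n : nat) (j : 'I_n) : 'rV[R]_n := delta_mx 0 j.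

Definition dx (n : nat) (f : 'rV[R]_n -> R) (j : 'I_n) (x : 'rV[R]_n) : R :=
  derive f x (ev j).

Definition grad (n : nat) (f : 'rV[R]_n -> R) (x : 'rV[R]_n) : 'rV[R]_n :=
  \row_j dx f j x.

Definition dt (n : nat) (p : R -> 'rV[R]_n -> R) (t : R) (x : 'rV[R]_n) : R :=
  derive1 (fun s => p s x) t.

Definition Jac (n : nat) (p : 'I_n -> R -> 'rV[R]_n -> R) (t : R) (x : 'rV[R]_n) : R :=
  \det (\matrix_(i, j) grad (p i t) x 0 j).

Definition adotgrad (n : nat) (a : 'rV[R]_n) (g : 'rV[R]_n) : R :=
  \sum_(j < n) a 0 j * g 0 j.

Fixpoint Dk (m : nat) (vs : seq 'rV[R]_m) (f : 'rV[R]_m -> R) : 'rV[R]_m -> R :=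
  match vs with
  | [::] => f
  | v :: vs' => fun x => derive (Dk vs' f) x v
  end.

Definition smooth (m : nat) (f : 'rV[R]_m -> R) : Prop :=
  forall (vs : seq 'rV[R]_m) (x : 'rV[R]_m), differentiable (Dk vs f) x.

Definition test_fun (n : nat) (T : R) (phi : R -> 'rV[R]_n -> R) : Prop :=
  smooth (fun z : 'rV[R]_(1 + n) => phi (lsubmx z 0 0) (rsubmx z)) /\
  exists (e r : R), [/\ 0 < e, e < T - e &
    forall t x, phi t x <> 0 -> e <= t <= T - e /\ `|x| <= r].

Definition openT (T : R) : set R := `]0, T[%classic.

Definition weak_sol (n : nat) (T : R) (a : R -> 'rV[R]_n -> 'rV[R]_n)
    (pi : R -> 'rV[R]_n -> R) : Prop :=
  forall phi, test_fun T phi ->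
    (\int[@lebesgue_measure R]_(t in openT T)
       iint (fun x => (pi t x * (dt phi t x + adotgrad (a t x) (grad (phi t) x)))%:E))%E
    = 0%E.

Definition WT (n : nat) (T : R) (a : R -> 'rV[R]_n -> 'rV[R]_n)
    (pi : R -> 'rV[R]_n -> R) : Prop :=
  Cw_Linf_loc T pi /\ weak_sol T a pi.

End Defs.

(* Main.v *)
(** For Lipschitz functions [u_1, ..., u_m] on R^m, one of which has bounded
support, the integral of [det (grad u_1, ..., grad u_m)] vanishes.  By
multilinearity the rows can be treated one at a time: a locally Lipschitz
function is, on a given ball, a uniform limit with bounded gradients of linear
combinations of the exponentials [exp (k . x)] (Bernstein polynomials in the
variables [exp x_j]), so its gradient is a weak-* limit, and for exponentials
the determinant is [exp (K . x) (c . grad phi)] with constant [c] orthogonal to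
[K], whose integral is zero.

In space-time, with [u_0] a test function and the other rows [p_1, ..., p_N],
this is the transport equation: adding [a_j] times the [j]-th space column to
the time column clears the latter below its first entry, because
[dt p_i + a . grad p_i = 0].  In space at fixed time it moves the derivatives of
[p_i (t) - p_i (s)] onto a Lipschitz test function, so that the Jacobian is
continuous in time when tested against Lipschitz functions, hence, being locally
bounded, against all of L^1. *)
Require Import Defs.
From HB Require Import structures.
From mathcomp Require Import finmap.
From mathcomp Require Import all_boot all_order all_algebra.
From mathcomp Require Import all_classical all_reals all_analysis.
From mathcomp Require Import measurable_realfun ring lra.
Set Implicit Arguments. Unset Strict Implicit. Unset Printing Implicit Defensive.
Import Order.TTheory GRing.Theory Num.Theory.
Import numFieldNormedType.Exports.
Local Open Scope classical_set_scope.
Local Open Scope ring_scope.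

(** * Borel sets and Lebesgue measure on R^n *)

(** Weak-* limits do not pass through products, so the rows of the determinant cannot all be
    approximated at once. Changing a single row leaves its cofactors fixed; these are bounded and
    vanish where the row of bounded support does, hence are admissible test functions. Exponentials
    make the last determinant explicit, so that the only cancellation ever needed is that [dx w j]
    has integral zero for Lipschitz [w] of bounded support: no row is differentiated twice.
    Bernstein averages of a Lipschitz function have gradients bounded independently of the degree. A
    second obstacle is that the statement speaks of the iterated integral [iint] of integrands
    controlled only up to null sets. A measure [leb n] is built by the same recursion, and [iint f]
    is identified with the integral of any integrable function equal to [f] almost everywhere. Since
    a missing derivative has the value 0, [dx f j] is measurable and bounded on balls at every point
    when [f] is locally Lipschitz. The [p i] are Lipschitz only for times in [0, T], with constants
    depending on the ball; clamping time and space extends them to all of space-time. *)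

Lemma clamp_lip {R : realType} (a b s t : R) :
  `|Num.max a (Num.min s b) - Num.max a (Num.min t b)| <= `|s - t|.
Proof.
have h1 := ler_norm (s - t); have h2 := ler_norm (t - s).
rewrite distrC in h2; rewrite /Num.max /Num.min ler_norml.
move: (`|s - t|) h1 h2 => d h1 h2.
have [? | ?] := ltP s b; have [? | ?] := ltP t b;
  do 2 (case: ltP => ?); apply/andP; split; lra.
Qed.

Lemma ex_harmonic_lt {R : realType} (e : R) : 0 < e -> exists k : nat, k.+1%:R^-1 < e.
Proof.
move=> e0; near \oo => k; exists k; near: k.
have /cvgrPdist_lt/(_ _ e0) := @cvg_harmonic R.
by apply: filterS => k /=; rewrite sub0r normrN ger0_norm.
Unshelve. all: by end_near. Qed.

Section vec.
Context {R : realType}.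

(** Spelled exactly as the argument inside [iint], so that unfolding one step of [iint] exposes
    [vcons]. *)
Definition vcons (n : nat) (x : R) (v : 'rV[R]_n) : 'rV[R]_(1 + n) :=
  row_mx (x%:M : 'rV[R]_1) v.
Definition vhd (n : nat) (z : 'rV[R]_(1 + n)) : R := lsubmx z 0 0.
Definition vtl (n : nat) (z : 'rV[R]_(1 + n)) : 'rV[R]_n := rsubmx z.

Lemma vhdK n (x : R) (v : 'rV[R]_n) : vhd (vcons x v) = x.
Proof. by rewrite /vhd /vcons row_mxKl mxE eqxx mulr1n. Qed.

Lemma vtlK n (x : R) (v : 'rV[R]_n) : vtl (vcons x v) = v.
Proof. by rewrite /vtl /vcons row_mxKr. Qed.

Lemma vconsK n (z : 'rV[R]_(1 + n)) : vcons (vhd z) (vtl z) = z.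
Proof.
rewrite /vcons /vhd /vtl -[RHS]hsubmxK; congr row_mx.
by apply/rowP => i; rewrite !ord1 mxE eqxx mulr1n.
Qed.

Lemma vconsD n (x y : R) (v w : 'rV[R]_n) :
  vcons x v + vcons y w = vcons (x + y) (v + w).
Proof. by rewrite /vcons add_row_mx raddfD. Qed.

Lemma vconsN n (x : R) (v : 'rV[R]_n) : - vcons x v = vcons (- x) (- v).
Proof. by rewrite /vcons opp_row_mx raddfN. Qed.

Lemma vcons0 n (x : R) (v : 'rV[R]_n) : vcons x v 0 (lshift n 0) = x.
Proof. by rewrite /vcons row_mxEl mxE eqxx mulr1n. Qed.

Lemma vconsS n (x : R) (v : 'rV[R]_n) j : vcons x v 0 (rshift 1 j) = v 0 j.
Proof. by rewrite /vcons row_mxEr. Qed.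

Lemma rV_norm_le n (v : 'rV[R]_n) (r : R) :
  (`|v| <= r) = (0 <= r) && [forall j, `|v 0 j| <= r].
Proof.
apply/idP/andP => [h|[r0 /forallP h]].
  split; first exact: le_trans h.
  apply/forallP => j; apply: le_trans h.
  rewrite /Num.norm/= mx_normrE.
  exact: (@le_bigmax _ _ _ 0 (fun i : 'I_1 * 'I_n => `|v i.1 i.2|) (0, j)).
rewrite /Num.norm/= mx_normrE; apply/bigmax_leP; split=> // -[i j] _ /=.
by rewrite ord1.
Qed.

Lemma rV_coord_le n (v : 'rV[R]_n) j : `|v 0 j| <= `|v|.
Proof. by have := lexx `|v|; rewrite {1}rV_norm_le => /andP[_ /forallP]. Qed.

Lemma vcons_norm_le n (x : R) (v : 'rV[R]_n) (r : R) :
  (`|vcons x v| <= r) = (`|x| <= r) && (`|v| <= r).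
Proof.
apply/idP/andP => [|[xr]].
  rewrite rV_norm_le => /andP[r0 /forallP h].
  split; first by have := h (lshift n 0); rewrite vcons0.
  rewrite rV_norm_le r0; apply/forallP => j.
  by have := h (rshift 1 j); rewrite vconsS.
rewrite !rV_norm_le => /andP[r0 /forallP h]; rewrite r0; apply/forallP => j.
by case: (split_ordP j) => k ->; rewrite ?ord1 ?vcons0 ?vconsS.
Qed.

Lemma vcons_continuous n : continuous (fun z : R * 'rV[R]_n => vcons z.1 z.2).
Proof.
move=> [x v] /=; apply/cvgrPdist_le => e e0.
near=> z; rewrite vconsN vconsD vcons_norm_le; apply/andP; split.
  near: z.
  have /cvgrPdist_le : fst @ (x, v) --> x by exact: cvg_fst.
  exact.
near: z.
have /cvgrPdist_le : snd @ (x, v) --> v by exact: cvg_snd.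
exact.
Unshelve. all: by end_near. Qed.

Lemma vhd_continuous n : continuous (@vhd n).
Proof.
have -> : @vhd n = fun z => z 0 (lshift n 0).
  by apply/funext => z; rewrite /vhd mxE.
exact: coord_continuous.
Qed.

Lemma vtl_continuous n : continuous (@vtl n).
Proof.
move=> z; apply/(@cvgrPdist_le _ _ _ (nbhs z)) => e e0.
apply/nbhs_ballP; exists e => // w; rewrite -ball_normE/= => /ltW.
rewrite -{1}(vconsK z) -{1}(vconsK w) vconsN vconsD vcons_norm_le.
by case/andP.
Qed.

End vec.

(** An alias that carries the sigma-algebra generated by the open sets, so that [Borel] and
    [measurable] agree by conversion. *)
Definition bor (R : realType) (n : nat) : Type := 'rV[R]_n.

Section bor_measurable.
Context {R : realType} (n : nat).
Let G := [set U : set 'rV[R]_n | open U].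

HB.instance Definition _ := Pointed.on (bor R n).
HB.instance Definition _ := @isMeasurable.Build default_measure_display
  (bor R n) <<s G >> (@sigma_algebra0 _ setT G) (@sigma_algebraC _ G)
  (@sigma_algebra_bigcup _ setT G).

End bor_measurable.

Section borel.
Context {R : realType}.

Lemma open_bor n (U : set 'rV[R]_n) : open U -> measurable (U : set (bor R n)).
Proof. by move=> oU; exact: sub_sigma_algebra. Qed.

Lemma closed_bor n (U : set 'rV[R]_n) : closed U -> measurable (U : set (bor R n)).
Proof. by move=> cU; rewrite -(setCK U); apply: measurableC; apply: open_bor; rewrite openC. Qed.

Lemma measurable_to_bor d (T : measurableType d) n (f : T -> 'rV[R]_n) :
  (forall U, open U -> measurable (f @^-1` U)) ->
  measurable_fun setT (f : T -> bor R n).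
Proof.
move=> h; refine (@measurability _ _ T (bor R n) setT f [set U | open U] (erefl _) _).
by move=> _ [U oU <-]; rewrite setTI; exact: h.
Qed.

Lemma continuous_bor n (f : 'rV[R]_n -> R) : continuous f ->
  measurable_fun setT (f : bor R n -> R).
Proof.
move=> cf; refine (@measurability _ _ (bor R n) (measurableTypeR R) setT f _ (RGenOpens.measurableE R) _) => _ [_ [a [b ->]] <-].
rewrite setTI; apply: open_bor.
by apply: open_comp => // x _; exact: cf.
Qed.

Lemma continuous_bor_bor m n (f : 'rV[R]_m -> 'rV[R]_n) : continuous f ->
  measurable_fun setT (f : bor R m -> bor R n).
Proof.
move=> cf; apply: measurable_to_bor => U oU; apply: open_bor.
by apply: open_comp => // x _; exact: cf.
Qed.

(* Rational vectors are dense, so an open set is a countable union of products. *)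
Lemma open_prod_measurable n (W : set (R * 'rV[R]_n)) : open W ->
  measurable (W : set (measurableTypeR R * bor R n)).
Proof.
move=> oW.
pose q (i : 'rV[rat]_n) : 'rV[R]_n := map_mx ratr i.
pose A (i : 'rV[rat]_n) (k : nat) : set R :=
  interior [set x | forall v, `|v - q i| < k.+1%:R^-1 -> W (x, v)].
have -> : W = \bigcup_(j in [set: 'rV[rat]_n * nat])
    (A j.1 j.2 `*` [set v | `|v - q j.1| < j.2.+1%:R^-1]).
  apply/seteqP; split => [[x v] Wxv|[x v] [[i k] _] /= [/interior_subset]]; last first.
    by move=> /= h /h.
  have : nbhs (x, v) W by exact: open_nbhs_nbhs.
  case=> -[/= P Q] [/nbhs_ballP[e e0 xe] /nbhs_ballP[d d0 vd]] PQ.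
  have [k kd] := ex_harmonic_lt (divr_gt0 d0 (ltr0Sn R 1)).
  have [i iv] : exists i : 'rV[rat]_n, `|v - q i| < k.+1%:R^-1 :> R.
    have k0 : (0 : R) < k.+1%:R^-1 / 2 by rewrite divr_gt0// invr_gt0.
    have h j : exists s : rat, `|v 0 j - ratr s| <= k.+1%:R^-1 / 2 :> R.
      have vk : v 0 j < v 0 j + k.+1%:R^-1 / 2 by rewrite ltrDl.
      have [s] := rat_in_itvoo vk.
      rewrite in_itv/= => /andP[s1 s2]; exists s.
      by rewrite distrC ger0_norm ?subr_ge0 ?lerBlDl; exact: ltW.
    exists (\row_j projT1 (cid (h j))).
    apply: (@le_lt_trans _ _ (k.+1%:R^-1 / 2)); last first.
      by rewrite ltr_pdivrMr// ltr_pMr ?invr_gt0// ltr1n.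
    rewrite rV_norm_le (ltW k0)/=; apply/forallP => j; rewrite !mxE.
    by case: (cid (h j)).
  exists (i, k) => //; split => //=.
  rewrite /A/= /interior/=; apply/nbhs_ballP; exists e => // y xy w wi.
  apply: (PQ (y, w)); split; first exact: xe.
  apply: vd; rewrite -ball_normE/= -(subrK (q i) v) -addrA.
  rewrite (le_lt_trans (ler_normD _ _))// (splitr d) ltrD//.
    exact: lt_trans kd.
  by rewrite distrC; exact: lt_trans kd.
apply: countable_bigcupT_measurable => [|[i k] /=]; first exact: countableP.
apply: measurableX; first by apply: open_measurable; exact: open_interior.
apply: open_bor.
have -> : [set v | `|v - q i| < k.+1%:R^-1] = ball (q i) k.+1%:R^-1.
  by rewrite -ball_normE; apply/seteqP; split => v /=; rewrite distrC.
by apply: ball_open; rewrite invr_gt0.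
Qed.

Lemma vcons_measurable n :
  measurable_fun setT (fun z : measurableTypeR R * bor R n => vcons z.1 z.2 : bor R (1 + n)).
Proof.
apply: measurable_to_bor => U oU; apply: open_prod_measurable.
by apply: open_comp => // x _; exact: vcons_continuous.
Qed.

Lemma vhd_measurable n : measurable_fun setT (@vhd R n : bor R (1 + n) -> measurableTypeR R).
Proof. by apply: continuous_bor; exact: vhd_continuous. Qed.

Lemma vtl_measurable n : measurable_fun setT (@vtl R n : bor R (1 + n) -> bor R n).
Proof. by apply: continuous_bor_bor; exact: vtl_continuous. Qed.

End borel.

(** * Lebesgue measure on R^n and its translation invariance *)

Section lebesgue_vec.
Context {R : realType}.
Local Open Scope ereal_scope.

(** The pushforward under a translation agrees with Lebesgue measure on half-open intervals, and
    these determine it. *)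
Lemma lebesgue_measure_shift (h : R) (A : set (measurableTypeR R)) :
  measurable A ->
  lebesgue_measure ((fun x : measurableTypeR R => (x + h)%R) @^-1` A) = lebesgue_measure A.
Proof.
move=> mA.
have mf : measurable_fun setT (fun x : measurableTypeR R => (x + h)%R : measurableTypeR R).
  by apply: measurable_funD => //; exact: measurable_cst.
pose f : measurableTypeR R -> measurableTypeR R := fun x => (x + h)%R.
pose m : {measure set (measurableTypeR R) -> \bar R} :=
  measure_function_pushforward__canonical__measure_function_Measure lebesgue_measure mf.
apply/esym; apply: (@lebesgue_measure_unique R m) => //.
move=> X /ocitvP[->|[[a b] /= ab ->]]; first by rewrite !measure0.
rewrite /m/= /pushforward.
have -> : f @^-1` `]a, b]%classic = `](a - h)%R, (b - h)%R]%classic.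
  by apply/seteqP; split => x /=; rewrite /f !in_itv/= ltrBlDr lerBrDr.
by rewrite !lebesgue_measure_itv/= !lte_fin ltrD2r ab -!EFinD; congr EFin; lra.
Qed.

Section push_cons.
Variables (n : nat) (mu : {sigma_finite_measure set (bor R n) -> \bar R}).

Let vc (z : measurableTypeR R * bor R n) : bor R (1 + n) := vcons z.1 z.2.

Definition mucons (A : set (bor R (1 + n))) : \bar R :=
  (@lebesgue_measure R \x mu) (vc @^-1` A).

Let mvc : measurable_fun setT vc. Proof. exact: vcons_measurable. Qed.
Let m : {measure set (bor R (1 + n)) -> \bar R} :=
  measure_function_pushforward__canonical__measure_function_Measure
    (@lebesgue_measure R \x mu) mvc.
HB.instance Definition _ := isMeasure.Build _ _ _ mucons
  (measure0 m) (measure_ge0 m) (@measure_semi_sigma_additive _ _ _ m).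

Lemma vcons_image_measurable (A : set (measurableTypeR R * bor R n)) :
  measurable A -> measurable (vc @` A).
Proof.
move=> mA.
have -> : vc @` A = (fun z : bor R (1 + n) => (vhd z, vtl z)) @^-1` A.
  apply/seteqP; split => [_ [[x v] Axv <-]|z Az]; first by rewrite /preimage/= /vc vhdK vtlK.
  by exists (vhd z, vtl z) => //; rewrite /vc vconsK.
rewrite -[X in measurable X]setTI.
by apply: (measurable_fun_pair (@vhd_measurable R n) (@vtl_measurable R n)).
Qed.

Lemma mucons_vcons (A : set (measurableTypeR R * bor R n)) :
  mucons (vc @` A) = (@lebesgue_measure R \x mu) A.
Proof.
rewrite /mucons [X in product_measure1 _ _ X](_ : _ = A)//.
apply/seteqP; split => [[x v] [[y w] Ayw]|z Az]; last by exists z.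
rewrite /vc => /= e; suff <- : (y, w) = (x, v) by [].
by congr pair; [rewrite -(vhdK y w) e vhdK|rewrite -(vtlK y w) e vtlK].
Qed.

Let mucons_sigma_finite : sigma_finite setT mucons.
Proof.
have /sigma_finiteP[F [TF ndF Foo]] := sigma_finiteT (@lebesgue_measure R).
have /sigma_finiteP[G [TG ndG Goo]] := sigma_finiteT mu.
exists (fun k => vc @` (F k `*` G k)).
  rewrite -image_bigcup; apply/esym; rewrite -subTset => z _.
  exists (vhd z, vtl z); last by rewrite /vc vconsK.
  have : [set: R] (vhd z) by [].
  have : [set: bor R n] (vtl z) by [].
  rewrite TF TG => -[k _ Gk] [l _ Fl]; exists (maxn k l) => //; split => /=.
    by move: (vhd z) Fl; exact/subsetPset/ndF/leq_maxr.
  by move: (vtl z) Gk; exact/subsetPset/ndG/leq_maxl.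
move=> k; have [? ?] := Foo k; have [? ?] := Goo k.
split; first by apply: vcons_image_measurable; exact: measurableX.
by rewrite mucons_vcons product_measure1E// lte_mul_pinfty// ge0_fin_numE.
Qed.

HB.instance Definition _ := @Measure_isSigmaFinite.Build _ _ _ mucons mucons_sigma_finite.

End push_cons.

(** The recursion mirrors that of [iint]; the Dirac mass in dimension 0 corresponds to evaluation at
    0. Sigma-finiteness is carried along because the next product measure needs it. *)
Fixpoint leb (n : nat) : {sigma_finite_measure set (bor R n) -> \bar R} :=
  match n with
  | 0 => @dirac _ (bor R 0) (0%R : 'rV[R]_0) R
  | n'.+1 => mucons (leb n')
  end.

Lemma ge0_integral_lebesgue_shift (f : measurableTypeR R -> \bar R) (h : R) :
  measurable_fun setT f -> (forall x, 0 <= f x) ->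
  \int[lebesgue_measure]_x f (x + h)%R = \int[lebesgue_measure]_x f x.
Proof.
move=> mf f0.
have ms : measurable_fun setT (fun x : measurableTypeR R => (x + h)%R : measurableTypeR R).
  by apply: measurable_funD => //; exact: measurable_cst.
have := @ge0_integral_pushforward _ _ _ _ R _ ms lebesgue_measure setT f measurableT mf (fun x _ => f0 x).
rewrite preimage_setT /comp => <-.
apply: eq_measure_integral => A mA _.
by rewrite /= /pushforward lebesgue_measure_shift.
Qed.

Lemma vcons_preimage_measurable n (A : set (bor R (1 + n))) : measurable A ->
  measurable ((fun z : measurableTypeR R * bor R n => vcons z.1 z.2) @^-1` A).
Proof.
by move=> mA; rewrite -[X in measurable X]setTI; exact: vcons_measurable.
Qed.

Lemma lebSE n (A : set (bor R n.+1)) :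
  leb n.+1 A = \int[lebesgue_measure]_x leb n [set v | A (vcons x v)].
Proof.
apply: eq_integral => x _ /=; congr (leb n _).
by apply/seteqP; split => v /=; rewrite /xsection/= inE.
Qed.

Lemma measurable_fun_leb_section n (A : set (bor R n.+1)) : measurable A ->
  measurable_fun setT (fun x : measurableTypeR R => leb n [set v | A (vcons x v)]).
Proof.
move=> mA; have := measurable_fun_xsection (leb n) (vcons_preimage_measurable mA).
apply: eq_measurable_fun => x _ /=; congr (leb n _).
by apply/seteqP; split => v /=; rewrite /xsection/= inE.
Qed.

Lemma measurable_section n (A : set (bor R n.+1)) x : measurable A ->
  measurable ([set v | A (vcons x v)] : set (bor R n)).
Proof.
move=> mA; have := measurable_xsection x (vcons_preimage_measurable mA).
rewrite (_ : xsection _ _ = [set v | A (vcons x v)])//.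
by apply/seteqP; split => v /=; rewrite /xsection/= inE.
Qed.

Lemma leb_shift n (v : 'rV[R]_n) (A : set (bor R n)) : measurable A ->
  leb n ((fun x : bor R n => (x + v)%R) @^-1` A) = leb n A.
Proof.
elim: n v A => [|n IH] v A mA.
  by congr (leb 0 _); apply/seteqP; split => x /=; rewrite (thinmx0 v) addr0.
rewrite !lebSE.
rewrite -(ge0_integral_lebesgue_shift (vhd v) (measurable_fun_leb_section mA) (fun=> measure_ge0 _ _)).
apply: eq_integral => x _.
rewrite -[in RHS](IH (@vtl R n v)); last exact: measurable_section.
by congr (leb n _); apply/seteqP; split => w /=; rewrite -vconsD vconsK.
Qed.

Lemma closed_norm_le n (r : R) : closed [set x : 'rV[R]_n | (`|x| <= r)%R].
Proof.
rewrite (_ : [set x | _] = (fun x : 'rV[R]_n => `|x|%R) @^-1` [set x : R | (x <= r)%R])//.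
by apply: closed_comp => [x _|]; [exact: norm_continuous|exact: closed_le].
Qed.

Lemma open_norm_lt n (r : R) : open [set x : 'rV[R]_n | (`|x| < r)%R].
Proof.
rewrite (_ : [set x | _] = (fun x : 'rV[R]_n => `|x|%R) @^-1` [set x : R | (x < r)%R])//.
by apply: open_comp => [x _|]; [exact: norm_continuous|exact: open_lt].
Qed.

Lemma measurable_norm_le n (r : R) :
  measurable ([set x : 'rV[R]_n | (`|x| <= r)%R] : set (bor R n)).
Proof. by apply: closed_bor; exact: closed_norm_le. Qed.

Lemma leb_norm_le_fin n (r : R) : leb n [set x : 'rV[R]_n | (`|x| <= r)%R] < +oo.
Proof.
elim: n => [|n IH]; first by rewrite /= diracE ltry.
rewrite lebSE.
have mr := @measurable_norm_le n.+1 r.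
apply: (@le_lt_trans _ _ (\int[lebesgue_measure]_(x in `[(- r)%R, r]) leb n [set x : 'rV[R]_n | (`|x| <= r)%R])).
  rewrite [leRHS]integral_mkcond; apply: ge0_le_integral => //.
  - exact: measurable_fun_leb_section.
  - by apply/(measurable_restrictT _ _).1 => //; exact: measurable_cst.
  move=> x _; rewrite patchE; case: ifPn => [_|/negP xr].
    apply: le_measure; rewrite ?inE.
    + exact: (measurable_section x mr).
    + exact: measurable_norm_le.
    + by move=> v /=; rewrite vcons_norm_le => /andP[].
  rewrite (_ : [set v | _] = set0) ?measure0//; apply/seteqP; split => v //=.
  by rewrite vcons_norm_le ler_norml => /andP[xr' _]; apply: xr; rewrite inE/= in_itv.
rewrite integral_cst//= lte_mul_pinfty//.
  by rewrite ge0_fin_numE.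
by rewrite lebesgue_measure_itv/=; case: ifP => // _; rewrite ltry.
Qed.

End lebesgue_vec.

Section integral_negligible.
Local Open Scope ereal_scope.
Import HBNNSimple.

(* [ae_eq_integral] without any measurability: the integral is the supremum over
   simple functions from below, which are insensitive to a null set. *)
Lemma negligible_eq_integral d (T : measurableType d) (R : realType)
    (mu : {measure set T -> \bar R}) (f g : T -> \bar R) :
  mu.-negligible [set x | f x <> g x] -> \int[mu]_x f x = \int[mu]_x g x.
Proof.
suff wlog_le (F G : T -> \bar R) : (forall x, 0 <= G x) ->
    mu.-negligible [set x | F x <> G x] ->
    ereal_sup [set sintegral mu h | h in [set h : {nnsfun T >-> R} | forall x, (h x)%:E <= F x]] <=
    ereal_sup [set sintegral mu h | h in [set h : {nnsfun T >-> R} | forall x, (h x)%:E <= G x]].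
  move=> fg; rewrite /integral !patch_setT.
  have fgC : mu.-negligible [set x | g x <> f x].
    by apply: negligibleS fg => x /= gf fg; apply: gf.
  have pos (u v : T -> \bar R) (N : mu.-negligible [set x | u x <> v x]) :
      mu.-negligible [set x | u^\+ x <> v^\+ x].
    by apply: negligibleS N => x /= uv e; apply: uv; rewrite !funeposE e.
  have neg (u v : T -> \bar R) (N : mu.-negligible [set x | u x <> v x]) :
      mu.-negligible [set x | u^\- x <> v^\- x].
    by apply: negligibleS N => x /= uv e; apply: uv; rewrite !funenegE e.
  congr (_ - _); apply/eqP; rewrite eq_le; apply/andP; split; apply: wlog_le => //.
  - exact: pos.
  - exact: pos.
  - exact: neg.
  - exact: neg.
move=> G0 [B [mB muB FGB]]; apply: ge_ereal_sup => _ [h /= hF <-].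
pose h' : {nnsfun T >-> R} := proj_nnsfun h (measurableC mB).
have h'E x : h' x = (h x * (x \in ~` B)%:R)%R by rewrite /h'/= mindicE.
have -> : sintegral mu h = sintegral mu h'.
  rewrite -!integralT_nnsfun; apply: ae_eq_integral => //.
  - exact/measurable_EFinP.
  - exact/measurable_EFinP.
  exists B; split => // x /= xh; apply: contrapT => Bx; apply: xh => _.
  by congr EFin; apply: esym; rewrite -[LHS]/(h' x) h'E mem_set// mulr1.
suff hG x : (h' x)%:E <= G x by apply: ereal_sup_ubound; exists h'.
rewrite h'E; have [|xB] := boolP (x \in ~` B); last by rewrite mulr0.
rewrite inE mulr1 => Bx; rewrite (le_trans (hF x))//.
suff -> : F x = G x by [].
by apply: contrapT => FG; apply: Bx; exact: FGB.
Qed.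

End integral_negligible.

(** * The iterated integral as an integral against [leb n] *)

Section iterated.
Context {R : realType}.
Local Open Scope ereal_scope.

Lemma ge0_integral_lebS n (f : bor R n.+1 -> \bar R) : measurable_fun setT f ->
  (forall x, 0 <= f x) ->
  \int[leb n.+1]_z f z = \int[lebesgue_measure]_x \int[leb n]_v f (vcons x v).
Proof.
move=> mf f0.
have mc := @vcons_measurable R n.
have := @ge0_integral_pushforward _ _ _ (bor R n.+1) R _ mc (lebesgue_measure \x leb n)%E setT f measurableT mf (fun x _ => f0 x).
rewrite preimage_setT.
rewrite (fubini_tonelli1 (f \o (fun z : measurableTypeR R * bor R n => vcons z.1 z.2 : bor R n.+1)))//=.
  exact: measurableT_comp.
Qed.

Lemma integrable_lebS n (f : bor R n.+1 -> \bar R) :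
  (leb n.+1).-integrable setT f ->
  (@lebesgue_measure R \x leb n)%E.-integrable setT
    (fun z : measurableTypeR R * bor R n => f (vcons z.1 z.2)).
Proof.
move=> /integrableP[mf fi]; apply/integrable12ltyP => //=.
  by apply: (measurableT_comp mf); exact: vcons_measurable.
rewrite -(ge0_integral_lebS (f := abse \o f))//; first exact: measurableT_comp.
by move=> x; exact: abse_ge0.
Qed.

Lemma integral_lebS n (f : bor R n.+1 -> \bar R) : 
  (leb n.+1).-integrable setT f ->
  \int[leb n.+1]_z f z = \int[lebesgue_measure]_x \int[leb n]_v f (vcons x v).
Proof.
move=> fi; have fi' := integrable_lebS fi.
have [mf _] := integrableP _ _ _ fi.
have mc := @vcons_measurable R n.
have := @integral_pushforward _ _ _ (bor R n.+1) R _ mc (lebesgue_measure \x leb n)%E setT f mf.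
rewrite preimage_setT => /(_ fi' measurableT).
rewrite -(integral12_prod_meas1 fi') => <-.
by apply: eq_measure_integral.
Qed.

Lemma iint_ge0E n (f : bor R n -> \bar R) : measurable_fun setT f ->
  (forall x, 0 <= f x) -> iint f = \int[leb n]_x f x.
Proof.
elim: n f => [|n IH] f mf f0; first by rewrite /= integral_dirac ?diracT ?mul1e.
rewrite ge0_integral_lebS//=; apply: eq_integral => x _; apply: IH => //.
by have := measurableT_comp mf (@vcons_measurable R n) => /(@measurable_fun_pair2 _ _ _ _ _ _ _ x).
Qed.

Lemma negligible_section n (A : set (bor R n.+1)) : (leb n.+1).-negligible A ->
  {ae @lebesgue_measure R, forall x, (leb n).-negligible [set v | A (vcons x v)]}.
Proof.
case=> B [mB B0 AB].
have mS := measurable_fun_leb_section mB.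
have : ae_eq lebesgue_measure setT (fun x => leb n [set v | B (vcons x v)]) (cst 0).
  apply/(ae_eq_integral_abs lebesgue_measure measurableT mS).1.
  rewrite -[RHS]B0 lebSE; apply: eq_integral => x _.
  by rewrite gee0_abs.
apply: filterS => x /(_ I) Bx; exists [set v | B (vcons x v)]; split => //.
  exact: measurable_section.
by move=> v /AB.
Qed.

(** Null sets of R^(n+1) have null sections above almost every first coordinate, so the induction
    discards a null set of coordinates at each level. [negligible_eq_integral] permits this without
    measurability of [f]. *)
Lemma iint_negligible n (f g : bor R n -> \bar R) :
  (leb n).-integrable setT g -> (leb n).-negligible [set x | f x <> g x] ->
  iint f = \int[leb n]_x g x.
Proof.
elim: n f g => [|n IH] f g gi N.
  have [mg _] := integrableP _ _ _ gi.
  rewrite /= integral_dirac ?diracT ?mul1e//; apply: contrapT => fg.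
  case: N => B [mB + fgB]; rewrite /= /dirac/= indicE mem_set/=; last exact: fgB.
  by move/eqP; rewrite eqe oner_eq0.
rewrite integral_lebS//=; apply: negligible_eq_integral.
have h1 := negligible_section N.
(* The sections of [g] are integrable only for almost every [x]; the exceptional coordinates join
   those whose section of the bad set is not null. *)
have h2 := ae_integrable1 (integrable_lebS gi).
have [B [mB B0 sub]] := negligibleU h1 h2; exists B; split => // x /= xfg.
apply: sub; apply: contrapT => /not_orP[/contrapT N1 /contrapT N2]; apply: xfg.
exact: IH.
Qed.

Lemma nullN_negligible n (A : set 'rV[R]_n) : nullN A <-> (leb n).-negligible (A : set (bor R n)).
Proof.
have E (B : set (bor R n)) : measurable B -> iint (fun x => ((\1_B x : R))%:E) = leb n B.
  move=> mB; rewrite iint_ge0E//; first by rewrite integral_indic// setIT.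
  by apply/measurable_EFinP; exact: measurable_indic.
split=> [[B [mB AB B0]]|[B [mB B0 AB]]]; exists B; split => //.
  by rewrite -(E B mB).
by rewrite (E B mB).
Qed.

Lemma nullTX_negligible n (A : set (R * 'rV[R]_n)) : nullTX A ->
  (leb n.+1).-negligible [set z : bor R n.+1 | A (@vhd R n z, vtl z)].
Proof.
case=> B [bB AB B0].
have mB : measurable [set z : bor R n.+1 | B (@vhd R n z, vtl z)].
  (* [B] is Borel for the product topology of R and R^n. The sets with measurable pullback to
     R^(1+n) form a sigma-algebra containing the open ones, hence contain [B]. *)
  apply: (@smallest_sub _ _ _ [set B | measurable [set z : bor R n.+1 | B (@vhd R n z, vtl z)]] _ _ B bB).
    split.
    - exact: measurable0.
    - by move=> C mC; rewrite setTD; apply: measurableC.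
    - by move=> F mF; exact: (bigcupT_measurable (fun i => [set z : bor R n.+1 | F i (@vhd R n z, vtl z)])).
  move=> U /= oU; apply: open_bor.
  apply: (@open_comp _ _ (fun z : 'rV[R]_(1+n) => (vhd z, vtl z))) => // z _.
  exact: (cvg_pair (@vhd_continuous R n z) (@vtl_continuous R n z)).
exists [set z : bor R n.+1 | B (@vhd R n z, vtl z)]; split => //; last by move=> z /AB.
rewrite -B0 lebSE; apply: eq_integral => x _.
have mBx := measurable_section x mB.
rewrite iint_ge0E//.
  rewrite -[X in leb n X]setIT -integral_indic//; apply: eq_integral => v _.
  rewrite !indicE; congr ((nat_of_bool _)%:R%:E).
  by apply/idP/idP; rewrite !inE/= vhdK vtlK.
rewrite (_ : (fun v => _) = (fun v => (\1_[set v : bor R n | B (x, v)] v : R)%:E))//.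
apply/measurable_EFinP; apply: measurable_indic.
rewrite (_ : mkset _ = [set v | [set z : bor R n.+1 | B (@vhd R n z, vtl z)] (vcons x v)])//.
by apply/seteqP; split => v /=; rewrite vhdK vtlK.
Qed.

End iterated.

(** * Lipschitz functions are differentiable almost everywhere *)

Section lipschitz_derivable.
Context {R : realType}.
Let lam := @lebesgue_measure R.

Section stieltjes.
Variables (F : cumulative R R) (C : R).
Hypothesis C0 : 0 < C.
Hypothesis FC : forall x y, x <= y -> F y - F x <= C * (y - x).

Lemma lebesgue_stieltjes_measure_ocitv (a b : R) : a <= b ->
  lebesgue_stieltjes_measure F `]a, b] = (F b - F a)%:E.
Proof.
move=> ab; rewrite /lebesgue_stieltjes_measure /measure_extension/=.
by rewrite measurable_mu_extE/=; [rewrite wlength_itv_bnd|exact: is_ocitv].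
Qed.

(** A null set is covered by half-open intervals of total length below [e / C]; the [F]-length of
    each is at most [C] times its length. *)
Lemma lebesgue_stieltjes_dominated : lebesgue_stieltjes_measure F `<< lam.
Proof.
apply/null_content_dominatesP => A mA A0; apply/eqP; rewrite eq_le measure_ge0 andbT.
apply/lee_addgt0Pr => e e0; rewrite add0e.
have : (lam A < (e / C)%:E)%E.
  by rewrite [X in (X < _)%E](_ : _ = 0%E)// lte_fin divr_gt0.
move=> /ereal_inf_lt[_ [D [mD AD] <-] Dlt].
apply: (@le_trans _ _ (\sum_(0 <= k <oo) wlength F (D k))%E).
  by apply: ereal_inf_lbound; exists D.
apply: (@le_trans _ _ (\sum_(0 <= k <oo) C%:E * wlength idfun (D k))%E).
  apply: lee_nneseries => [k _ _|k _]; first exact: wlength_ge0.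
  have /ocitvP[->|[[a b] /= ab ->]] := mD k; first by rewrite !wlength0 mule0.
  by rewrite !wlength_itv_bnd ?(ltW ab)// -EFinM lee_fin FC// ltW.
rewrite nneseriesZl; last by move=> k _; exact: wlength_ge0.
by rewrite muleC -lee_pdivlMr// ltW.
Qed.

End stieltjes.

(** The Lebesgue-Stieltjes measure of [F] is absolutely continuous. By Radon-Nikodym [F] is locally
    a constant plus the integral of a density, and the fundamental theorem of calculus gives
    derivability almost everywhere. *)
Lemma cumulative_derivable_ae (F : R -> R) (C : R) : 0 < C ->
  (forall x y, x <= y -> 0 <= F y - F x <= C * (y - x)) ->
  lam.-negligible [set x | ~ derivable F x 1].
Proof.
move=> C0 FC.
have ndF : {homo F : x y / x <= y}.
  by move=> x y /FC /andP[]; rewrite subr_ge0.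
have rcF : right_continuous F.
  move=> x; apply/cvgrPdist_le => e e0; near=> y.
  have xy : x <= y by near: y; exact: nbhs_right_ge.
  have /andP[h1 h2] := FC _ _ xy.
  rewrite distrC ger0_norm// (le_trans h2)// -ler_pdivlMl// lerBlDl mulrC.
  by near: y; apply: nbhs_right_le; rewrite ltrDl divr_gt0.
pose FcM := isCumulative.Build _ _ _ F ndF rcF.
pose Fc : cumulative R R := HB.pack F FcM.
pose nu : {measure set (measurableTypeR R) -> \bar R} := lebesgue_stieltjes_measure Fc.
have nu_dom : nu `<< lam.
  by apply: (lebesgue_stieltjes_dominated C0) => x y /FC /andP[].
have nuE (a b : R) : a <= b -> nu `]a, b]%classic = (F b - F a)%:E.
  by move=> ab; exact: (lebesgue_stieltjes_measure_ocitv Fc ab).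
(* Restriction to a bounded interval makes the measure finite, as Radon-Nikodym is applied to a
   finite measure; countably many intervals exhaust the line. *)
have step (n : nat) : lam.-negligible [set x | - n%:R < x < n%:R /\ ~ derivable F x 1].
  set D := `]- n%:R, n%:R]%classic : set (measurableTypeR R).
  have mD : measurable D by exact: measurable_itv.
  have Dfin : (nu D < +oo)%E by rewrite /D nuE ?ltry// lerNl (le_trans _ (ler0n _ _))// oppr_le0.
  pose nuD := mfrestr mD Dfin.
  have nuD_dom : nuD `<< lam.
    apply/null_content_dominatesP => A mA A0; rewrite /nuD/= /mfrestr /mrestr.
    have /null_content_dominatesP := nu_dom; apply; first exact: measurableI.
    by apply/eqP; rewrite eq_le measure_ge0 andbT -A0 le_measure ?inE//; exact: measurableI.
  have [h [h0 hfin hint hE]] := radon_nikodym_sigma_finite nuD_dom.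
  pose g : R -> R := fine \o h.
  have hg : h = EFin \o g by apply/funext => x /=; rewrite fineK.
  rewrite hg in hint.
  have locg : locally_integrable setT g by apply: open_integrable_locally => //; exact: openT.
  have intg y : lam.-integrable [set` Interval (BRight (- n%:R)) (BRight y)] (EFin \o g).
    exact: integrableS hint.
  have /= := FTC1 intg locg.
  apply: negligibleS => x /= [/andP[nx xn] dF] /(_ nx)[dG _]; apply: dF.
  pose G y := \int[lam]_(t in `]- n%:R, y]) g t.
  have GF y : - n%:R <= y <= n%:R -> G y + F (- n%:R) = F y.
    move=> /andP[ny yn]; rewrite /G /Rintegral.
    have := hE `]- n%:R, y]%classic (measurable_itv _); rewrite hg => <-.
    rewrite /nuD/= /mfrestr /mrestr [X in nu X](_ : _ = `]- n%:R, y]%classic); last first.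
      apply/seteqP; split => z /=; first by case.
      by rewrite /D/= !in_itv/= => /andP[-> zy]; rewrite zy (le_trans zy).
    by rewrite nuE//= subrK.
  apply: (@near_eq_derivable _ _ _ (fun y => G y + F (- n%:R))).
    have xI : x \in `]- n%:R, n%:R[ by rewrite in_itv/= nx.
    near=> y; have /= : y \in `]- n%:R, n%:R[ by near: y; exact: near_in_itvoo.
    by rewrite in_itv/= => /andP[/ltW ny /ltW yn]; apply: GF; rewrite ny.
  by apply: derivableD => //; exact: derivable_cst.
apply: negligibleS (negligible_bigcup step) => x /= dx.
exists (Num.bound `|x|) => //=; split => //.
by rewrite -ltr_norml; exact: archi_boundP.
Unshelve. all: by end_near. Qed.

(** Adding the linear function of slope [L + 1] makes [f] nondecreasing, with slopes at most
    [2 L + 1]; the extra 1 keeps this bound positive even when [L] is 0. *)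
Lemma lipschitz_derivable_ae (f : R -> R) (L : R) :
  (forall x y, `|f x - f y| <= L * `|x - y|) ->
  lam.-negligible [set x | ~ derivable f x 1].
Proof.
move=> fL.
have L0 : 0 <= L by have := fL 1 0; rewrite subr0 normr1 mulr1; apply: le_trans.
pose F x := f x + (L + 1) * x.
have FC x y : x <= y -> 0 <= F y - F x <= (L + L + 1) * (y - x).
  move=> xy; have := fL y x; rewrite (@ger0_norm _ (y - x)) ?subr_ge0// ler_norml /F.
  by move=> /andP[h1 h2]; apply/andP; split; nra.
have C0 : 0 < L + L + 1 by lra.
apply: negligibleS (cumulative_derivable_ae C0 FC) => x /= df dF; apply: df.
have -> : f = F - (fun y => (L + 1) *: y).
  by apply/funext => y; rewrite /F !fctE addrK.
apply: derivableB => //; apply: derivableZ; exact: derivable_id.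
Qed.

End lipschitz_derivable.

Section continuous_arith.
Context {R : realType} {T : topologicalType}.
Implicit Types f g : T -> R.

Lemma cont_sub f g : continuous f -> continuous g -> continuous (fun x => f x - g x).
Proof. by move=> cf cg x; exact: (@cvgB _ _ _ (nbhs x) _ _ _ _ _ (cf x) (cg x)). Qed.

Lemma cont_mul f g : continuous f -> continuous g -> continuous (fun x => f x * g x).
Proof. by move=> cf cg x; exact: (@cvgM _ _ (nbhs x) _ _ _ _ _ (cf x) (cg x)). Qed.

Lemma cont_norm f : continuous f -> continuous (fun x => `|f x|).
Proof. by move=> cf x; exact: (continuous_comp (cf x) (@norm_continuous _ _ (f x))). Qed.

End continuous_arith.

(** * Directional derivatives: measurability and bounds *)

Section partial.
Context {R : realType} {n : nat}.
Implicit Types (f g : 'rV[R]_n -> R) (v x : 'rV[R]_n).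

(** [L] may be negative when the ball has at most one point, hence the absolute values around such
    constants below. *)
Definition loc_lip f := forall r : R, exists L : R, forall x y,
  `|x| <= r -> `|y| <= r -> `|f x - f y| <= L * `|x - y|.

Definition dquot f v (h : R) x : R := h^-1 * (f (h *: v + x) - f x).

Lemma derivableE f x v : derivable f x v = cvg (dquot f v h x @[h --> 0^']).
Proof. by []. Qed.

Lemma deriveE' f x v : 'D_v f x = lim (dquot f v h x @[h --> 0^']).
Proof. by []. Qed.

(** The limit of a divergent quotient is the default point 0. This makes the bounds on derivatives
    valid at every point. *)
Lemma derive_not_derivable f x v : ~ derivable f x v -> 'D_v f x = 0.
Proof. by move=> /dvgP. Qed.

Lemma loc_lip_continuous f : loc_lip f -> continuous f.
Proof.
move=> fL x; have [L fLr] := fL (`|x| + 1).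
apply/(@cvgrPdist_le _ _ _ (nbhs x)) => e e0; near=> y.
have xy : `|x - y| <= 1.
  near: y; apply: (@cvgr_dist_le _ _ _ (nbhs x)) => //; exact: cvg_id.
have yr : `|y| <= `|x| + 1.
  by rewrite -(subrK x y) (le_trans (ler_normD _ _))// addrC lerD2l distrC.
rewrite (le_trans (fLr _ _ _ yr))//; first by rewrite lerDl.
apply: (@le_trans _ _ ((`|L| + 1) * `|x - y|)).
  by rewrite ler_wpM2r// (le_trans (ler_norm _))// lerDl.
rewrite mulrC -ler_pdivlMr ?ltr_wpDl//; near: y.
apply: (@cvgr_dist_le _ _ _ (nbhs x)); first exact: cvg_id.
by rewrite divr_gt0// ltr_wpDl.
Unshelve. all: by end_near. Qed.

Lemma dquot_continuous f v h : continuous f -> continuous (dquot f v h).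
Proof.
move=> cf; apply: cont_mul; first exact: cst_continuous.
apply: cont_sub => // x; refine (@continuous_comp _ _ _ (fun x => h *: v + x) f x _ _); last exact: cf.
by refine (@cvgD _ _ _ (nbhs x) _ _ _ _ _ _ _); [exact: cvg_cst|exact: cvg_id].
Qed.

(* Cauchy's criterion; the inner sets are arbitrary intersections of closed sets. *)
Lemma derivable_setE f v : continuous f ->
  [set x | derivable f x v] = \bigcap_k \bigcup_l
    \bigcap_(h in [set h : R * R | 0 < `|h.1| < l.+1%:R^-1 /\ 0 < `|h.2| < l.+1%:R^-1])
     [set x | `|dquot f v h.1 x - dquot f v h.2 x| <= k.+1%:R^-1].
Proof.
move=> cf; apply/seteqP; split => x /=.
  rewrite derivableE => /cvg_ex[/= d dd] k _.
  have k0 : (0 : R) < k.+1%:R^-1 / 2 by rewrite divr_gt0// invr_gt0.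
  have := @cvgr_dist_le _ _ _ _ _ _ _ dd _ k0.
  move=> [e /= e0 de].
  have [l le] := ex_harmonic_lt e0.
  exists l => // -[h h'] /= [/andP[h0 hl] /andP[h'0 h'l]].
  rewrite [leRHS](splitr _) -(subrK d (dquot f v h x)) -addrA.
  rewrite (le_trans (ler_normD _ _))// lerD//.
    rewrite distrC; apply: de; rewrite -?normr_gt0//=.
    by rewrite sub0r normrN; exact: lt_trans le.
  apply: de; rewrite -?normr_gt0//=.
  by rewrite sub0r normrN; exact: lt_trans le.
move=> H; rewrite derivableE; apply/cauchy_cvgP/cauchyP => e e0.
have [k ke] := ex_harmonic_lt e0.
have [l _ Hl] := H k I.
have l0 : (0 : R) < l.+1%:R^-1 / 2 by rewrite divr_gt0// invr_gt0.
have ll : l.+1%:R^-1 / 2 < l.+1%:R^-1 :> R by rewrite ltr_pdivrMr// ltr_pMr ?invr_gt0// ltr1n.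
exists (dquot f v (l.+1%:R^-1 / 2) x); exists l.+1%:R^-1; rewrite /= ?invr_gt0//.
move=> h /=; rewrite sub0r normrN -normr_gt0 => hl h0.
rewrite -ball_normE/=; apply: le_lt_trans ke; apply: (Hl (_, _)) => /=.
by split; apply/andP; split => //; rewrite gtr0_norm.
Qed.

Lemma measurable_derivable f v : continuous f ->
  measurable ([set x | derivable f x v] : set (bor R n)).
Proof.
move=> cf; rewrite derivable_setE//; apply: bigcapT_measurable => k.
apply: bigcupT_measurable => l; apply: closed_bor; apply: closed_bigI => h _.
rewrite (_ : mkset _ = (fun x => `|dquot f v h.1 x - dquot f v h.2 x|) @^-1` [set y : R | y <= k.+1%:R^-1])//.
apply: closed_comp => [x _|]; last exact: closed_le.
by apply: cont_norm; apply: cont_sub; exact: dquot_continuous.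
Qed.

Lemma measurable_derive f v : continuous f ->
  measurable_fun setT ((fun x => 'D_v f x) : bor R n -> R).
Proof.
move=> cf.
pose D : set (bor R n) := [set x | derivable f x v].
have mD : measurable D by exact: measurable_derivable.
(* Multiplying the quotients by [\1_D] makes them converge everywhere: off [D] they are 0, and so is
   the derivative by convention. *)
refine (@measurable_fun_cvg _ (bor R n) R setT (fun k x => dquot f v k.+1%:R^-1 x * \1_D x) _ _ _).
  move=> k; apply: measurable_funM; last exact: measurable_indic.
  by apply: continuous_bor; exact: dquot_continuous.
move=> x _; rewrite indicE; have [|xD] := boolP (x \in D).
  rewrite inE => dx; under eq_fun do rewrite mulr1.
  have /cvg_ex[/= d dd] : cvg (dquot f v h x @[h --> 0^']) := dx.
  have -> : 'D_v f x = d by apply/cvg_lim.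
  have /cvgr_dnbhsP := dd; apply; split => [k|]; first by rewrite gt_eqF// invr_gt0.
  exact: cvg_harmonic.
rewrite derive_not_derivable; last by move=> dx; move/negP: xD; apply; rewrite inE.
by under eq_fun do rewrite mulr0; exact: cvg_cst.
Qed.

Lemma derive_le f (r L : R) x v :
  (forall y z, `|y| <= r -> `|z| <= r -> `|f y - f z| <= L * `|y - z|) ->
  `|x| < r -> `|'D_v f x| <= L * `|v|.
Proof.
move=> fL xr.
have xr' := ltW xr.
(* For nonzero [v] the ball contains the two distinct points [x] and [c *: v + x], which rules out a
   negative [L]. *)
have L0 : 0 <= L * `|v|.
  have [->|v0] := eqVneq v 0; first by rewrite normr0 mulr0.
  apply: mulr_ge0 => //; rewrite leNgt; apply/negP => Ln.
  pose c := (r - `|x|) / `|v|.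
  have c0 : 0 < c by rewrite divr_gt0 ?subr_gt0 ?normr_gt0.
  have : `|c *: v| <= r - `|x| by rewrite normrZ gtr0_norm// divfK// normr_eq0.
  have := fL (c *: v + x) x; rewrite addrK => h1 h2.
  have : `|f (c *: v + x) - f x| <= L * `|c *: v|.
    apply: h1 => //; rewrite (le_trans (ler_normD _ _))//; lra.
  rewrite leNgt => /negP; apply; rewrite (lt_le_trans _ (normr_ge0 _))//.
  by rewrite nmulr_rlt0// normrZ mulr_gt0// normr_gt0// gt_eqF.
have [dx|ndx] := pselect (derivable f x v); last first.
  by rewrite derive_not_derivable// normr0.
rewrite deriveE'; have := dx; rewrite derivableE => dx'.
rewrite -lim_norm//.
apply: limr_le; first exact: is_cvg_norm.
near=> h.
rewrite /dquot normrM normfV.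
have h0 : 0 < `|h| by rewrite normr_gt0; near: h; exact: nbhs_dnbhs_neq.
rewrite ler_pdivrMl// mulrA (mulrC _ L) -mulrA -normrZ -[X in _ * `|X|](addrK x).
apply: fL => //.
have : `|h| * `|v| <= r - `|x|.
  apply: (@le_trans _ _ (`|h| * (`|v| + 1))); first by rewrite ler_wpM2l// lerDl.
  rewrite -ler_pdivlMr ?ltr_wpDl//; near: h.
  by apply: dnbhs0_le; apply: divr_gt0; rewrite ?subr_gt0// ltr_wpDl.
rewrite -normrZ => hv; rewrite (le_trans (ler_normD _ _))//; lra.
Unshelve. all: by end_near. Qed.

End partial.

(** * Derivability along almost every point, and the integral of a derivative *)

Section integration.
Context {R : realType} {n : nat}.
Implicit Types (f g w : 'rV[R]_n -> R) (v x : 'rV[R]_n).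
Let T := bor R n.

(** Tonelli for the set of pairs [(s, x)] with [s] in [0, 1] and [s *: v + x] in [A]: integrating in
    [x] first gives [leb n A] by translation invariance, integrating in [s] first gives 0. *)
Lemma null_along v (A : set T) : measurable A ->
  (forall x, lebesgue_measure ([set s : measurableTypeR R | A (s *: v + x)]) = 0%E) ->
  leb n A = 0%E.
Proof.
move=> mA A0.
pose P : set (measurableTypeR R * T) := [set z | z.1 \in `[0, 1] /\ A (z.1 *: v + z.2)].
have mf : measurable_fun setT (fun z : measurableTypeR R * T => z.1 *: v + z.2 : T).
  apply: measurable_to_bor => U oU; apply: open_prod_measurable.
  apply: (@open_comp _ _ (fun z : R * 'rV[R]_n => z.1 *: v + z.2)) => // z _.
  refine (@cvgD _ _ _ (nbhs z) _ _ _ _ _ _ _); last exact: cvg_snd.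
  refine (@cvgZ _ _ _ (nbhs z) _ _ _ _ _ _ _); last exact: cvg_cst.
  exact: cvg_fst.
have mP : measurable P.
  have -> : P = (fst @^-1` `[0, 1]%classic) `&` ((fun z : measurableTypeR R * T => z.1 *: v + z.2 : T) @^-1` A) by [].
  apply: measurableI; last by rewrite -[X in measurable X]setTI; exact: mf.
  by rewrite -[X in measurable X]setTI; exact: measurable_fst.
have := indic_fubini_tonelli (@lebesgue_measure R) (leb n) mP.
rewrite indic_fubini_tonelli_FE// indic_fubini_tonelli_GE//.
rewrite [RHS](_ : _ = 0%E); last first.
  apply: integral0_eq => x _ /=.
  apply/eqP; rewrite eq_le measure_ge0 andbT -(A0 x); apply: le_measure; rewrite ?inE.
  - exact: measurable_ysection.
  - have : measurable_fun setT (fun s : measurableTypeR R => s *: v + x : T).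
      exact: (measurable_fun_pair1 x mf).
    by move=> /(_ measurableT A mA); rewrite setTI.
  - by move=> s /=; rewrite /ysection/= inE => -[].
move=> <-; transitivity (\int[@lebesgue_measure R]_(x in `[0%R, 1%R]) (leb n A))%E.
  rewrite integral_cst//= lebesgue_measure_itv/= lte_fin ltr01.
  by rewrite sube0 mule1.
rewrite [LHS]integral_mkcond; apply: eq_integral => s _ /=; rewrite patchE.
case: ifPn => [s01|s01].
  rewrite -[LHS](leb_shift (s *: v))//; congr (leb n _).
  apply/seteqP; split => x /=; rewrite /xsection/= inE.
    by move=> Ax; split; [move: s01; rewrite inE|rewrite addrC].
  by case=> _; rewrite addrC.
rewrite (_ : xsection _ _ = set0) ?measure0//; apply/seteqP; split => x //=.
by rewrite /xsection/= inE => -[s01' _]; move/negP: s01; apply; rewrite inE.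
Qed.

(** Along every line of direction [v] the function is locally Lipschitz in one variable, so the bad
    set meets each such line in a null set and [null_along] applies. *)
Lemma loc_lip_derivable_ae f v : loc_lip f ->
  (leb n).-negligible ([set x | ~ derivable f x v] : set T).
Proof.
move=> fL; have cf := loc_lip_continuous fL.
have mN : measurable ([set x | ~ derivable f x v] : set T).
  by have := measurableC (measurable_derivable v cf).
exists [set x | ~ derivable f x v]; split => //.
apply: (@null_along v) => // x.
set N := (X in lebesgue_measure X).
suff : (@lebesgue_measure R).-negligible N.
  case=> B [mB B0 NB]; apply/eqP; rewrite eq_le measure_ge0 andbT -B0 le_measure ?inE//.
  have mf : measurable_fun setT (fun s : measurableTypeR R => s *: v + x : T).
    apply: measurable_to_bor => U oU; apply: open_measurable.
    apply: open_comp => // s _.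
    refine (@cvgD _ _ _ (nbhs s) _ _ _ _ _ _ _); last exact: cvg_cst.
    exact: (@cvgZ _ _ _ (nbhs s) _ _ _ _ _ (@cvg_id _ _) (@cvg_cst _ _ _ _ _)).
  by have := mf measurableT _ mN; rewrite setTI.
have step (k : nat) : (@lebesgue_measure R).-negligible [set s | - k%:R < s < k%:R /\ ~ derivable f (s *: v + x) v].
  (* Clamping the parameter makes the restriction to the line globally Lipschitz without changing it
     near any [s] in the open interval. *)
  pose cl s : R := Num.max (- k%:R) (Num.min s k%:R).
  have k0 : - k%:R <= k%:R :> R by rewrite (le_trans _ (ler0n _ _))// oppr_le0.
  have clk s : `|cl s| <= k%:R.
    rewrite ler_norml /cl le_max lexx/= ge_max k0/=.
    by rewrite ge_min lexx orbT.
  have cls s t : `|cl s - cl t| <= `|s - t| by exact: clamp_lip.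
  have [L fLr] := fL (k%:R * `|v| + `|x|).
  have gL s t : `|f (cl s *: v + x) - f (cl t *: v + x)| <= (`|L| * `|v|) * `|s - t|.
    have cB u : `|cl u *: v + x| <= k%:R * `|v| + `|x|.
      by rewrite (le_trans (ler_normD _ _))// lerD2r normrZ ler_wpM2r.
    apply: (le_trans (fLr _ _ (cB s) (cB t))).
    rewrite (_ : cl s *: v + x - (cl t *: v + x) = (cl s - cl t) *: v); last first.
      by rewrite opprD addrACA subrr addr0 scalerBl.
    rewrite normrZ (mulrC `|cl s - cl t|) mulrA.
    apply: (@le_trans _ _ (`|L| * `|v| * `|cl s - cl t|)).
      by rewrite ler_wpM2r// ler_wpM2r// ler_norm.
    by rewrite ler_wpM2l// mulr_ge0.
  apply: negligibleS (lipschitz_derivable_ae gL) => s /= [sk ndf] dg; apply: ndf.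
  have : derivable (fun s : R => f (s *: v + x)) s 1.
    apply: near_eq_derivable dg.
    have xI : s \in `]- k%:R, k%:R[ by rewrite in_itv/=.
    apply: filterS (near_in_itvoo xI) => y; rewrite in_itv/= => /andP[/ltW ny /ltW yn].
    by rewrite /cl min_l// max_r.
  suff E : (fun h : R => h^-1 *: (((fun s : R => f (s *: v + x)) \o shift s) (h *: 1) - f (s *: v + x)))
      = (fun h => h^-1 *: ((f \o shift (s *: v + x)) (h *: v) - f (s *: v + x))).
    by rewrite /derivable E.
  apply/funext => h /=.
  by rewrite [h *: 1]mulr1 scalerDl addrA.
apply: negligibleS (negligible_bigcup step) => s /= ds.
exists (Num.bound `|s|) => //=; split => //.
by rewrite -ltr_norml; exact: archi_boundP.
Unshelve. all: by end_near. Qed.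

Definition bdd_supp f := exists r : R, forall x, r < `|x| -> f x = 0.

Lemma integrable_cst_ball (M r : R) : (leb n).-integrable setT
  (fun x : T => (M * \1_[set x : T | `|x : 'rV[R]_n| <= r] x)%:E).
Proof.
have mB := @measurable_norm_le R n r.
apply/integrableP; split.
  by apply/measurable_EFinP; apply: measurable_funM => //; exact: measurable_indic.
under eq_integral do rewrite EFinM abseM.
rewrite ge0_integralZl//; last first.
  by do 2 apply: measurableT_comp => //; exact: measurable_indic.
apply: lte_mul_pinfty => //.
under eq_integral do rewrite gee0_abs ?lee_fin//.
by rewrite integral_indic// setIT; exact: leb_norm_le_fin.
Qed.

Lemma integrable_bounded f (M r : R) : measurable_fun setT (f : T -> R) ->
  (forall x, `|f x| <= M) -> (forall x, r < `|x| -> f x = 0) ->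
  (leb n).-integrable setT (EFin \o f : T -> \bar R).
Proof.
move=> mf fM fr.
apply: (le_integrable _ _ _ (integrable_cst_ball M r)) => //.
  exact/measurable_EFinP.
move=> x _ /=; rewrite lee_fin indicE.
have [|xr] := boolP (x \in _); first by rewrite mulr1 (le_trans (fM x))// ler_norm.
rewrite fr ?normr0//; rewrite ltNge; apply/negP => xr'; move/negP: xr; apply.
by rewrite inE.
Qed.

Lemma integrable_shift f v : (leb n).-integrable setT (EFin \o f : T -> \bar R) ->
  (leb n).-integrable setT (EFin \o (fun x => f (v + x)) : T -> \bar R) /\
  (\int[leb n]_x (f (v + x))%:E = \int[leb n]_x (f x)%:E)%E.
Proof.
move=> fi; have [mf ffin] := integrableP _ _ _ fi.
have ms : measurable_fun setT (fun x : T => v + x : T).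
  apply: continuous_bor_bor => x.
  by refine (@cvgD _ _ _ (nbhs x) _ _ _ _ _ _ _); [exact: cvg_cst|exact: cvg_id].
pose m : {measure set T -> \bar R} :=
  measure_function_pushforward__canonical__measure_function_Measure (leb n) ms.
have mE (A : set T) : measurable A -> A `<=` setT -> m A = leb n A.
  move=> mA _; rewrite -[RHS](leb_shift v mA) /m/=/pushforward; congr (leb n _).
  by apply/seteqP; split => x /=; rewrite addrC.
have fvi : (leb n).-integrable setT (EFin \o (fun x => f (v + x)) : T -> \bar R).
  apply/integrableP; split; first by apply: (measurableT_comp mf ms).
  have := @ge0_integral_pushforward _ _ _ _ R _ ms (leb n) setT (abse \o (EFin \o f)) measurableT (measurableT_comp (@abse_measurable R _) mf) (fun x _ => abse_ge0 _).
  rewrite preimage_setT /= => <-.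
  by rewrite (eq_measure_integral (leb n) mE).
split => //.
have := @integral_pushforward _ _ _ _ R _ ms (leb n) setT (EFin \o f) mf.
rewrite preimage_setT => /(_ fvi measurableT) /= <-.
exact: (eq_measure_integral (leb n) mE).
Qed.

(** Difference quotients have integral zero by translation invariance; they are bounded with a
    common bounded support, so dominated convergence carries this to the derivative. *)
Lemma integral_derive0 w v : loc_lip w -> bdd_supp w ->
  (\int[leb n]_x ('D_v w x)%:E = 0)%E.
Proof.
move=> wL [r wr]; have cw := loc_lip_continuous wL.
(* Outside radius [rho] all quotients vanish, because their steps have length at most [|v|]. The
   Lipschitz constant is taken on a larger ball that also contains the shifted points. *)
pose rho := `|r| + `|v| + 1.
have [L wLr] := wL (rho + `|v| + 1).
have rrho : r <= rho.
  by rewrite (le_trans (ler_norm r))// /rho -addrA lerDl addr_ge0.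
pose M := `|L| * `|v|.
have wbd : exists M0, forall x, `|w x| <= M0.
  exists (`|w 0| + `|L| * rho) => x.
  have [xr|xr] := leP `|x| rho; last first.
    rewrite wr ?normr0 ?addr_ge0 ?mulr_ge0//; last exact: le_lt_trans xr.
    by rewrite /rho !addr_ge0.
  rewrite -(subrK (w 0) (w x)) (le_trans (ler_normD _ _))// addrC lerD2l.
  have r1 : rho <= rho + `|v| + 1 by rewrite -addrA lerDl addr_ge0.
  apply: (le_trans (wLr _ _ (le_trans xr r1) _)).
    by rewrite normr0 (le_trans _ r1)// (le_trans _ xr).
  rewrite subr0; apply: (@le_trans _ _ (`|L| * `|x|)).
    by rewrite ler_wpM2r// ler_norm.
  by rewrite ler_wpM2l.
have [M0 wM0] := wbd.
have mw : measurable_fun setT (w : T -> R) by exact: continuous_bor.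
have wi := integrable_bounded mw wM0 wr.
pose q k x := dquot w v k.+1%:R^-1 x.
have k1 k : (k.+1%:R : R)^-1 <= 1 by rewrite invf_le1// ler1n.
have k0 k : 0 < (k.+1%:R : R)^-1 by rewrite invr_gt0.
have q0 k x : rho < `|x| -> q k x = 0.
  move=> xr; have w1 : w x = 0 by apply: wr; exact: le_lt_trans xr.
  rewrite /q /dquot w1 wr ?subrr ?mulr0//.
  have : `|x| <= `|k.+1%:R^-1 *: v + x| + `|v|.
    rewrite -{1}(addKr (k.+1%:R^-1 *: v) x) (le_trans (ler_normD _ _))// addrC lerD2l.
    by rewrite normrN normrZ gtr0_norm// ler_piMl.
  have := ler_norm r; rewrite /rho in xr; lra.
have M_ge0 : 0 <= M by rewrite mulr_ge0.
have qM k x : `|q k x| <= M * \1_[set x : T | `|x : 'rV[R]_n| <= rho] x.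
  rewrite indicE; have [|xr] := boolP (x \in _); last first.
    rewrite q0 ?normr0 ?mulr0// ltNge; apply/negP => xr'; move/negP: xr; apply.
    by rewrite inE.
  rewrite inE /= mulr1 => xr; rewrite /q /dquot normrM normfV (@gtr0_norm _ k.+1%:R^-1)// ler_pdivrMl//.
  have hv : `|k.+1%:R^-1 *: v| <= `|v| by rewrite normrZ gtr0_norm// ler_piMl.
  apply: (@le_trans _ _ (L * `|k.+1%:R^-1 *: v|)).
    rewrite -[X in _ * `|X|](addrK x); apply: wLr.
      by rewrite (le_trans (ler_normD _ _))//; lra.
    by rewrite (le_trans xr)// -addrA lerDl addr_ge0.
  rewrite normrZ (@gtr0_norm _ k.+1%:R^-1)// mulrCA ler_pM2l//.
  by rewrite /M ler_wpM2r// ler_norm.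
have mq k : measurable_fun setT (q k : T -> R).
  by apply: continuous_bor; exact: dquot_continuous.
have qi k : (leb n).-integrable setT (EFin \o q k : T -> \bar R).
  apply: (@integrable_bounded _ M rho) => // [x|x]; last exact: q0.
  by rewrite (le_trans (qM k x))// ler_piMr// indicE; case: (_ \in _).
have qint k : (\int[leb n]_x (q k x)%:E = 0)%E.
  have [wsi wse] := integrable_shift (k.+1%:R^-1 *: v) wi.
  rewrite /q /dquot; under eq_integral do rewrite EFinM EFinB.
  rewrite integralZl//; last exact: integrableB.
  rewrite (integralB measurableT wsi wi) wse subee ?mule0//.
  exact: integrable_fin_num wi.
have mD : measurable_fun setT ((fun x => 'D_v w x) : T -> R) by exact: measurable_derive.
have := @dominated_convergence _ T R (leb n) setT measurableT
  (fun k x => (q k x)%:E) (fun x => ('D_v w x)%:E)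
  (fun x => (M * \1_[set x : T | `|x : 'rV[R]_n| <= rho] x)%:E).
case => //.
- by move=> k; exact/measurable_EFinP.
- exact/measurable_EFinP.
- apply: negligibleS (loc_lip_derivable_ae v wL) => x /= ndx dx; apply: ndx => _.
  apply: cvg_EFin; first exact: nearW.
  have /cvg_ex[/= d dd] : cvg (dquot w v h x @[h --> 0^']) := dx.
  have -> : 'D_v w x = d by apply/cvg_lim.
  have /cvgr_dnbhsP := dd; apply; split => [k|]; first by rewrite gt_eqF.
  exact: cvg_harmonic.
- exact: integrable_cst_ball.
- by apply: aeW => x k _ /=; rewrite lee_fin.
move=> _ _; rewrite (_ : (fun k => _) = fun=> 0%E); last by apply/funext => k; exact: qint.
by move=> H; apply: (cvg_unique _ H); [exact: ereal_hausdorff|exact: cvg_cst].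
Qed.

End integration.

(** * Weak-* convergence *)

Section bump.
Context {R : realType} {n : nat}.
Implicit Types (U : set 'rV[R]_n) (x y : 'rV[R]_n).

(** The infimum of this set is the minimum of 1 and [k] times the distance from [x] to the
    complement of [U]: a [k]-Lipschitz function that tends to the indicator of an open [U]. The
    element 1 keeps the set nonempty when [U] is the whole space. *)
Definition bumpset U (k : R) x : set R :=
  [set Num.min 1 (k * `|x - y|) | y in ~` U] `|` [set 1].

Definition bump U (k : R) x : R := inf (bumpset U k x).

Lemma bumpset_lb U k x : 0 <= k -> lbound (bumpset U k x) 0.
Proof.
move=> k0 _ [[y _ <-]|->]; last exact: ler01.
by rewrite le_min ler01/= mulr_ge0.
Qed.

Lemma bump_ge0 U k x : 0 <= k -> 0 <= bump U k x.
Proof. by move=> k0; apply: lb_le_inf; [exists 1; right|exact: bumpset_lb]. Qed.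

Lemma bump_le U k x (s : R) : 0 <= k -> bumpset U k x s -> bump U k x <= s.
Proof. by move=> k0 xs; apply: ge_inf => //; exists 0; exact: bumpset_lb. Qed.

Lemma bump_le1 U k x : 0 <= k -> bump U k x <= 1.
Proof. by move=> k0; apply: bump_le => //; right. Qed.

Lemma bump_notin U k x : 0 <= k -> ~ U x -> bump U k x = 0.
Proof.
move=> k0 Ux; apply/eqP; rewrite eq_le bump_ge0// andbT; apply: bump_le => //.
by left; exists x => //; rewrite subrr normr0 mulr0 min_r// ler01.
Qed.

Lemma bump_lip U k x y : 0 <= k -> `|bump U k x - bump U k y| <= k * `|x - y|.
Proof.
move=> k0.
suff H u v : bump U k u - k * `|u - v| <= bump U k v.
  by rewrite ler_norml; have := H x y; have := H y x; rewrite (distrC y); lra.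
apply: lb_le_inf; first by exists 1; right.
move=> _ [[z Uz <-]|->]; last first.
  by rewrite lerBlDr (le_trans (bump_le1 _ _ _))// lerDl mulr_ge0.
have : bump U k u <= Num.min 1 (k * `|u - z|) by apply: bump_le => //; left; exists z.
rewrite !le_min => /andP[h1 h2]; apply/andP; split.
  by rewrite lerBlDr (le_trans h1)// lerDl mulr_ge0.
rewrite lerBlDr (le_trans h2)// -mulrDr ler_wpM2l// [leRHS]addrC.
by rewrite (le_trans _ (ler_normD _ _))// addrA subrK.
Qed.

Lemma bump_cvg U x : open U -> bump U k%:R x @[k --> \oo] --> (\1_U x : R).
Proof.
move=> oU; rewrite indicE; have [|Ux] := boolP (x \in U); last first.
  rewrite (_ : (fun k : nat => _) = fun=> 0); first exact: cvg_cst.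
  apply/funext => k; apply: bump_notin => // ux.
  by move/negP: Ux; apply; rewrite inE.
rewrite inE => Ux.
have /nbhs_ballP[e /= e0 xe] : nbhs x U by exact: open_nbhs_nbhs.
apply/cvgrPdist_le => d d0; near=> k.
have ke : 1 <= k%:R * e.
  rewrite -ler_pdivrMr// div1r; near: k.
  exact: nbhs_infty_ger.
suff -> : bump U k%:R x = 1 by rewrite subrr normr0 ltW.
apply/eqP; rewrite eq_le bump_le1//=; apply: lb_le_inf; first by exists 1; right.
move=> _ [[y Uy <-]|->//]; rewrite le_min lexx/= (le_trans ke)// ler_wpM2l//.
by rewrite leNgt; apply/negP => xy; apply: Uy; apply: xe; rewrite -ball_normE.
Unshelve. all: by end_near. Qed.

End bump.

Section weak_limit.
Context {R : realType} {n : nat} {I : Type} (F : set_system I) {FF : ProperFilter F}.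
Let T := bor R n.
Variables (f : I -> 'rV[R]_n -> R) (M r : R).
Let B : set T := [set x | `|x : 'rV[R]_n| < r].
Hypothesis mf : forall i, measurable_fun setT (f i : T -> R).
Hypothesis fM : forall i x, `|x| < r -> `|f i x| <= M.
Hypothesis ftest : forall g : 'rV[R]_n -> R, loc_lip g -> (forall x, ~ B x -> g x = 0) ->
  \int[leb n]_x (f i x * g x) @[i --> F] --> 0.

Let tested (psi : 'rV[R]_n -> R) := \int[leb n]_x (f i x * psi x) @[i --> F] --> 0.
(** Vanishing off [B] is required because [f i] is bounded only there. *)
Let good (psi : 'rV[R]_n -> R) := (leb n).-integrable setT (EFin \o psi : T -> \bar R) /\
  forall x, ~ B x -> psi x = 0.

Let goodM psi i : good psi -> (leb n).-integrable setT (EFin \o (fun x => f i x * psi x) : T -> \bar R).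
Proof.
move=> [psii psi0]; have [mpsi _] := integrableP _ _ _ psii.
have hi := @integrableZl _ _ _ (leb n) _ measurableT M _ psii.
apply: le_integrable hi => //.
  by apply/measurable_EFinP; apply: measurable_funM => //; exact/measurable_EFinP.
move=> x _ /=; rewrite lee_fin !normrM; have [xB|xB] := pselect (B x).
  by rewrite ler_wpM2r// (le_trans (fM i xB))// ler_norm.
by rewrite psi0// normr0 !mulr0.
Qed.

Let good_le psi i : good psi -> `|\int[leb n]_x (f i x * psi x)| <= `|M| * \int[leb n]_x `|psi x|.
Proof.
move=> gpsi; have [psii psi0] := gpsi.
have gi := goodM i gpsi.
rewrite (le_trans (le_normr_Rintegral _ gi))// -RintegralZl//; last first.
  exact: integrable_norm.
apply: le_Rintegral => //.
- exact: integrable_norm.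
- by have := @integrableZl _ _ _ (leb n) _ measurableT `|M| _ (integrable_norm psii).
move=> x _ /=; rewrite normrM; have [xB|xB] := pselect (B x).
  by rewrite ler_wpM2r// (le_trans (fM i xB))// ler_norm.
by rewrite psi0// normr0 !mulr0.
Qed.

Let good_lin a psi1 psi2 : good psi1 -> good psi2 ->
  good (fun x => a * psi1 x + psi2 x).
Proof.
move=> [i1 z1] [i2 z2]; split; last by move=> x xB; rewrite z1// z2// mulr0 addr0.
by have := integrableD measurableT (integrableZl measurableT a i1) i2.
Qed.

Let tested_lin a psi1 psi2 : good psi1 -> good psi2 -> tested psi1 -> tested psi2 ->
  tested (fun x => a * psi1 x + psi2 x).
Proof.
move=> g1 g2 t1 t2.
rewrite /tested (_ : (fun i => _) = fun i => a * \int[leb n]_x (f i x * psi1 x) + \int[leb n]_x (f i x * psi2 x)); last first.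
  apply/funext => i; rewrite -RintegralZl//; last exact: goodM.
  rewrite -RintegralD//; last 2 first.
  - by have := integrableZl measurableT a (goodM i g1).
  - exact: goodM.
  by apply: eq_Rintegral => x _; ring.
rewrite -[X in _ --> X]addr0 -[X in _ --> X + _](mulr0 a).
by apply: cvgD => //; apply: cvgM => //; exact: cvg_cst.
Qed.

(** The bound on [f i] is uniform in [i]: replacing [psi] by [h k] costs at most [|M|] times their
    L^1 distance, so [k] is fixed first and then the limit along [F] is taken. *)
Let tested_L1 (psi : 'rV[R]_n -> R) (h : nat -> 'rV[R]_n -> R) : good psi ->
  (forall k, good (h k)) -> (forall k, tested (h k)) ->
  (\int[leb n]_x `|(h k x)%:E - (psi x)%:E| @[k --> \oo] --> 0)%E -> tested psi.
Proof.
move=> gpsi gh th hpsi; apply/cvgrPdist_le => e e0.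
have gd k : good (fun x => (-1) * h k x + psi x) by exact: good_lin.
have dE k : (\int[leb n]_x `|(h k x)%:E - (psi x)%:E| = (\int[leb n]_x `|(-1) * h k x + psi x|)%:E)%E.
  rewrite /Rintegral fineK; last first.
    have [gi _] := gd k; exact: (integrable_fin_num measurableT (integrable_norm gi)).
  apply: eq_integral => x _ /=; rewrite distrC; congr (`|_|%:E); ring.
have /cvgrPdist_le : \int[leb n]_x `|(-1) * h k x + psi x| @[k --> \oo] --> 0.
  have /fine_cvgP[_] := hpsi; rewrite (_ : fine \o _ = fun k => \int[leb n]_x `|(-1) * h k x + psi x|)//.
  by apply/funext => k /=; rewrite dE.
have eM : 0 < e / 2 / (`|M| + 1) by rewrite !divr_gt0// ltr_wpDl.
move=> /(_ _ eM)[k _ /(_ k (leqnn k))]; rewrite sub0r normrN => hk.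
have /cvgrPdist_le/(_ (e / 2)) := th k.
rewrite divr_gt0// => /(_ isT); apply: filterS => i; rewrite !sub0r !normrN => hi.
have -> : \int[leb n]_x (f i x * psi x) =
    \int[leb n]_x (f i x * h k x) + \int[leb n]_x (f i x * ((-1) * h k x + psi x)).
  rewrite -RintegralD//; last 2 first.
  - exact: goodM.
  - exact: goodM.
  by apply: eq_Rintegral => x _; ring.
rewrite (le_trans (ler_normD _ _))// (splitr e) lerD//.
rewrite (le_trans (good_le i (gd k)))//.
rewrite ger0_norm in hk; last by apply: Rintegral_ge0 => x _.
rewrite ler_pdivlMr ?ltr_wpDl// in hk.
rewrite mulrC (le_trans _ hk)// ler_wpM2l ?lerDl//.
by apply: Rintegral_ge0 => x _.
Qed.

Let tested_dom (psi G : 'rV[R]_n -> R) (h : nat -> 'rV[R]_n -> R) : good psi ->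
  (forall k, good (h k)) -> (forall k, tested (h k)) ->
  (leb n).-integrable setT (EFin \o G : T -> \bar R) ->
  (forall k x, `|h k x| <= G x) -> (forall x, h k x @[k --> \oo] --> psi x) ->
  tested psi.
Proof.
move=> gpsi gh th Gi hG hpsi; apply: (tested_L1 gpsi gh th).
have [mh mpsi] : (forall k, measurable_fun setT (EFin \o h k : T -> \bar R)) /\
    measurable_fun setT (EFin \o psi : T -> \bar R).
  by split => [k|]; [have [/integrableP[]] := gh k|have [/integrableP[]] := gpsi].
have := @dominated_convergence _ T R (leb n) setT measurableT
  (fun k x => (h k x)%:E) (fun x => (psi x)%:E) (fun x => (G x)%:E) mh mpsi.
case => //.
- by apply: aeW => x _; apply: cvg_EFin; [exact: nearW|exact: hpsi].
- by apply: aeW => x k _ /=; rewrite lee_fin.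
Qed.

Let good_indic (A : set T) : measurable A -> good (\1_(A `&` B)).
Proof.
have mB : measurable B by apply: open_bor; exact: open_norm_lt.
move=> mA; split; last first.
  move=> x xB; rewrite indicE (_ : x \in _ = false)//; apply/negP.
  by rewrite inE => -[].
apply: (@integrable_bounded _ _ _ 1 r).
- by apply: measurable_indic; exact: measurableI.
- by move=> x; rewrite indicE; case: (_ \in _); rewrite ?normr1 ?normr0.
move=> x xr; rewrite indicE (_ : x \in _ = false)//; apply/negP.
by rewrite inE => -[_]; rewrite /B/= => /ltW; rewrite leNgt xr.
Qed.

Let tested_open (U : set 'rV[R]_n) : open U -> tested (\1_(U `&` B)).
Proof.
move=> oU; have oUB : open (U `&` B) by apply: openI => //; exact: open_norm_lt.
have gb k : good (bump (U `&` B) k%:R).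
  split; last by move=> x xB; apply: bump_notin => // -[].
  apply: (@integrable_bounded _ _ _ 1 r).
  - apply: continuous_bor; apply: loc_lip_continuous => s; exists k%:R => x y _ _.
    exact: bump_lip.
  - by move=> x; rewrite ger0_norm ?bump_le1 ?bump_ge0.
  move=> x xr; apply: bump_notin => // -[_]; rewrite /B/= => /ltW; by rewrite leNgt xr.
apply: (@tested_dom _ (fun x => 1 * \1_[set x : T | `|x : 'rV[R]_n| <= r] x) (fun k => bump (U `&` B) k%:R)) => //.
- by apply: good_indic; exact: open_bor.
- move=> k; apply: ftest => [s|x xB]; first by exists k%:R => x y _ _; exact: bump_lip.
  by apply: bump_notin => // -[].
- exact: integrable_cst_ball.
- move=> k x; rewrite mul1r indicE ger0_norm ?bump_ge0//.
  have [_|xr] := boolP (x \in _); first exact: bump_le1.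
  rewrite bump_notin// => -[_]; rewrite /B/= => /ltW xr'; move/negP: xr; apply.
  by rewrite inE.
- by move=> x; exact: bump_cvg.
Qed.

(** Dynkin's argument: open sets are stable under intersection, and the sets passing the test are
    stable under proper difference (linearity) and increasing union (dominated convergence). *)
Let tested_borel (A : set T) : measurable A -> tested (\1_(A `&` B)).
Proof.
pose H : set (set T) := [set A | measurable A /\ tested (\1_(A `&` B))].
suff : @measurable _ T `<=` H by move=> h /h[].
apply: (@lambda_system_subset _ [set U : set 'rV[R]_n | open U] _ setT).
- by move=> U V; exact: openI.
- split => //.
  + by split => //; exact: tested_open openT.
  + move=> C D DC [mC tC] [mD tD]; split; first exact: measurableD.
    have -> : \1_((C `\` D) `&` B) = (fun x : 'rV[R]_n => (-1) * \1_(D `&` B) x + \1_(C `&` B) x) :> ('rV[R]_n -> R).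
      apply/funext => x; rewrite !indicE setDE !in_setI in_setC.
      have : x \in D -> x \in C by rewrite !inE => /DC.
      case: (x \in D) => [/(_ isT) -> | _]; last case: (x \in C);
        case: (x \in B); rewrite /= ?(mulr0n, mulr1n); ring.
    exact: (@tested_lin (-1) _ _ (good_indic mD) (good_indic mC) tD tC).
  + move=> E ndE HE; split; first by apply: bigcupT_measurable => k; have [] := HE k.
    apply: (@tested_dom _ (fun x => 1 * \1_[set x : T | `|x : 'rV[R]_n| <= r] x) (fun k => \1_(E k `&` B))).
    * by apply: good_indic; apply: bigcupT_measurable => k; have [] := HE k.
    * by move=> k; apply: good_indic; have [] := HE k.
    * by move=> k; have [] := HE k.
    * exact: integrable_cst_ball.
    * move=> k x; rewrite mul1r !indicE ger0_norm//.
      have [|_] := boolP (x \in E k `&` B); last by rewrite ler_nat.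
      by rewrite inE => -[_ Bx]; rewrite mem_set//=; exact: ltW.
    * move=> x; rewrite indicE; have [|xA] := boolP (x \in _).
        rewrite inE => -[[k _ Ak] Bx].
        apply: cvg_near_cst; near=> l; rewrite indicE mem_set//; split => //.
        have kl : (k <= l)%N by near: l; exact: nbhs_infty_ge.
        by move: x Ak {Bx}; exact/subsetPset/ndE.
      rewrite (_ : (fun k => _) = fun=> 0); first exact: cvg_cst.
      apply/funext => k; rewrite indicE (_ : x \in _ = false)//; apply/negP.
      rewrite inE => -[Ak Bx]; move/negP: xA; apply; rewrite inE; split => //.
      by exists k.
- by move=> U oU; split; [exact: open_bor|exact: tested_open].
- by [].
Unshelve. all: by end_near. Qed.

Let tested_sum (s : seq R) (A : R -> set T) : (forall y, measurable (A y)) ->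
  good (fun x => \sum_(y <- s) y * \1_(A y `&` B) x) /\
  tested (fun x => \sum_(y <- s) y * \1_(A y `&` B) x).
Proof.
move=> mA; elim: s => [|y s [gs ts]].
  rewrite (_ : (fun x => _) = \1_(set0 `&` B)); last first.
    by apply/funext => x; rewrite big_nil set0I indic0.
  by split; [exact: good_indic|exact: tested_borel].
rewrite (_ : (fun x => _) = (fun x => y * \1_(A y `&` B) x + \sum_(y <- s) y * \1_(A y `&` B) x)); last first.
  by apply/funext => x; rewrite big_cons.
have gA := good_indic (mA y).
split; first exact: good_lin.
exact: (@tested_lin _ _ _ gA gs (tested_borel (mA y)) ts).
Qed.

Import HBSimple.
(** Test functions grow from Lipschitz ones to indicators of open and then Borel sets, to simple
    functions and finally to L^1. The filter is arbitrary because the lemma serves both a sequence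
    of approximations and a limit in time. *)
Lemma weak_limit (psi : 'rV[R]_n -> R) :
  (leb n).-integrable setT (EFin \o psi : T -> \bar R) ->
  (forall x, ~ `|x| < r -> psi x = 0) ->
  \int[leb n]_x (f i x * psi x) @[i --> F] --> 0.
Proof.
move=> psii psi0.
have [g [gi gpsi gL1]] := approximation_sfun_integrable measurableT psii.
(* Cutting the simple functions off by [\1_B] makes them [good]; as [psi] vanishes off [B], this
   does not increase their L^1 distance to [psi]. *)
have gg k : good (fun x => g k x * \1_B x) /\ tested (fun x => g k x * \1_B x).
  rewrite (_ : (fun x => _) = (fun x => \sum_(y <- fset_set (range (g k))) y * \1_((g k @^-1` [set y]) `&` B) x)).
    by apply: tested_sum => y; exact: measurable_sfunP.
  apply/funext => x; rewrite fimfunE fsbig_finite//= mulr_suml.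
  by apply: eq_bigr => y _; rewrite indicI mulrA.
have mB : measurable B by apply: open_bor; exact: open_norm_lt.
have mg k : measurable_fun setT (g k) by [].
have mpsi : measurable_fun setT (psi : T -> R) by have /integrableP[/measurable_EFinP] := psii.
apply: (@tested_L1 _ (fun k x => g k x * \1_B x)) => //.
- by move=> k; have [] := gg k.
- by move=> k; have [] := gg k.
apply: (@squeeze_cvge _ _ _ _ (fun=> 0%E) _ _ _ _ _ gL1); last exact: cvg_cst.
apply: nearW => k; apply/andP; split; first by apply: integral_ge0.
apply: ge0_le_integral => //.
- do 2 apply: measurableT_comp => //; apply: measurable_funB => //.
  by apply: measurable_funM => //; exact: measurable_indic.
- by do 2 apply: measurableT_comp => //; apply: measurable_funB.
move=> x _ /=; rewrite lee_fin distrC indicE; have [_|xB] := boolP (x \in B); first by rewrite mulr1.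
rewrite psi0 ?mulr0 ?subrr ?normr0// => xr; move/negP: xB; apply; by rewrite inE.
Qed.

End weak_limit.

(** * Calculus of locally Lipschitz functions *)

Section calculus.
Context {R : realType} {n : nat}.
Implicit Types (f g w : 'rV[R]_n -> R) (x : 'rV[R]_n).
Let T := bor R n.

Lemma loc_lip_bound f : loc_lip f -> forall r : R, exists M : R, forall x, `|x| <= r -> `|f x| <= M.
Proof.
move=> fL r; have [L fLr] := fL r; exists (`|f 0| + `|L| * `|r|) => x xr.
rewrite -(subrK (f 0) (f x)) (le_trans (ler_normD _ _))// addrC lerD2l.
apply: (le_trans (fLr _ _ xr _)); first by rewrite normr0 (le_trans _ xr).
rewrite subr0; apply: (@le_trans _ _ (`|L| * `|x|)).
  by rewrite ler_wpM2r// ler_norm.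
by rewrite ler_wpM2l// (le_trans xr)// ler_norm.
Qed.

Lemma loc_lip_cst (c : R) : loc_lip (fun _ : 'rV[R]_n => c).
Proof. by move=> r; exists 0 => x y _ _; rewrite subrr normr0 mul0r. Qed.

Lemma loc_lip_add f g : loc_lip f -> loc_lip g -> loc_lip (fun x => f x + g x).
Proof.
move=> fL gL r; have [L fLr] := fL r; have [K gKr] := gL r; exists (L + K) => x y xr yr.
rewrite opprD addrACA mulrDl (le_trans (ler_normD _ _))// lerD//; [exact: fLr|exact: gKr].
Qed.

Lemma loc_lip_mul f g : loc_lip f -> loc_lip g -> loc_lip (fun x => f x * g x).
Proof.
move=> fL gL r; have [L fLr] := fL r; have [K gKr] := gL r.
have [M fM] := loc_lip_bound fL r; have [M' gM] := loc_lip_bound gL r.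
exists (M * K + M' * L) => x y xr yr.
have -> : f x * g x - f y * g y = f x * (g x - g y) + g y * (f x - f y) by ring.
rewrite (le_trans (ler_normD _ _))// mulrDl !normrM -!mulrA lerD// ler_pM//;
  by [exact: fM|exact: gKr|exact: gM|exact: fLr].
Qed.

Lemma loc_lip_scale (c : R) f : loc_lip f -> loc_lip (fun x => c * f x).
Proof. by move=> fL; apply: loc_lip_mul => //; exact: loc_lip_cst. Qed.

Lemma loc_lip_sub f g : loc_lip f -> loc_lip g -> loc_lip (fun x => f x - g x).
Proof.
move=> fL gL; rewrite (_ : (fun x => _) = (fun x => f x + (-1) * g x)); last first.
  by apply/funext => x; rewrite mulN1r.
by apply: loc_lip_add => //; exact: loc_lip_scale.
Qed.

Lemma bdd_supp_mull f g : bdd_supp f -> bdd_supp (fun x => f x * g x).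
Proof. by move=> [r fr]; exists r => x xr; rewrite fr// mul0r. Qed.

Lemma negligible_forall (J : finType) (P : J -> set T) :
  (forall j, (leb n).-negligible (P j)) -> (leb n).-negligible [set x | exists j, P j x].
Proof.
move=> PN; suff H (s : seq J) : (leb n).-negligible [set x | exists2 j, j \in s & P j x].
  apply: negligibleS (H (enum J)) => x [j Pj] /=; exists j => //.
  by rewrite mem_enum.
elim: s => [|j s IH].
  by apply: (negligibleS _ (negligible_set0 _)) => x [].
apply: negligibleS (negligibleU (PN j) IH) => x [k]; rewrite inE => /predU1P[->|ks] Pk.
  by left.
by right; exists k.
Qed.

Lemma Rintegral_negligible f g : (leb n).-negligible ([set x | f x <> g x] : set T) ->
  \int[leb n]_x f x = \int[leb n]_x g x.
Proof.
move=> fg; rewrite /Rintegral; congr fine; apply: negligible_eq_integral.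
by apply: negligibleS fg => x /= fgx e; apply: fgx; rewrite e.
Qed.

Lemma dxM f g j : loc_lip f -> loc_lip g -> (leb n).-negligible
  ([set x | dx (fun x => f x * g x) j x <> f x * dx g j x + g x * dx f j x] : set T).
Proof.
move=> fL gL.
apply: negligibleS (negligibleU (loc_lip_derivable_ae (ev _ j) fL) (loc_lip_derivable_ae (ev _ j) gL)) => x /= h.
apply: contrapT => /not_orP[/contrapT df /contrapT dg]; apply: h.
exact: deriveM.
Qed.

Lemma dx_out f j (r : R) x : (forall y, r < `|y| -> f y = 0) -> r < `|x| -> dx f j x = 0.
Proof.
move=> fr xr; rewrite /dx (@near_eq_derive _ _ _ _ (cst 0)); first by rewrite derive_cst.
apply: filterS (_ : nbhs x [set y : 'rV[R]_n | r < `|y|]) => [y /=|]; first exact: fr.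
apply: open_nbhs_nbhs; split => //.
rewrite (_ : [set y | _] = ~` [set y : 'rV[R]_n | `|y| <= r]).
  by apply: closed_openC; exact: closed_norm_le.
by apply/seteqP; split => y /=; rewrite ltNge => /negP.
Qed.

(** The bound holds at every point rather than almost everywhere. The class contains partial
    derivatives of locally Lipschitz functions and is stable under forming determinants. *)
Definition loc_bdd f := measurable_fun setT (f : T -> R) /\
  forall r : R, exists M : R, forall x, `|x| <= r -> `|f x| <= M.

Lemma loc_lip_loc_bdd f : loc_lip f -> loc_bdd f.
Proof.
by move=> fL; split; [apply: continuous_bor; exact: loc_lip_continuous|exact: loc_lip_bound].
Qed.

Lemma loc_bdd_dx f j : loc_lip f -> loc_bdd (dx f j).
Proof.
move=> fL; split; first by apply: measurable_derive; exact: loc_lip_continuous.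
move=> r; have [L fLr] := fL (r + 1); exists (L * `|ev R j|) => x xr.
by apply: (derive_le _ fLr); rewrite (le_lt_trans xr)// ltrDl.
Qed.

Lemma loc_bdd_cst (c : R) : loc_bdd (fun=> c).
Proof. exact/loc_lip_loc_bdd/loc_lip_cst. Qed.

Lemma loc_bdd_add f g : loc_bdd f -> loc_bdd g -> loc_bdd (fun x => f x + g x).
Proof.
move=> [mf fM] [mg gM]; split; first exact: measurable_funD.
move=> r; have [M fr] := fM r; have [M' gr] := gM r; exists (M + M') => x xr.
by rewrite (le_trans (ler_normD _ _))// lerD//; [exact: fr|exact: gr].
Qed.

Lemma loc_bdd_mul f g : loc_bdd f -> loc_bdd g -> loc_bdd (fun x => f x * g x).
Proof.
move=> [mf fM] [mg gM]; split; first exact: measurable_funM.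
move=> r; have [M fr] := fM r; have [M' gr] := gM r; exists (M * M') => x xr.
by rewrite normrM ler_pM//; [exact: fr|exact: gr].
Qed.

Lemma loc_bdd_sum (J : Type) (s : seq J) (P : pred J) (F : J -> 'rV[R]_n -> R) :
  (forall j, loc_bdd (F j)) -> loc_bdd (fun x => \sum_(j <- s | P j) F j x).
Proof.
move=> bF; elim: s => [|j s IH].
  by rewrite (_ : (fun x => _) = fun=> 0); [exact: loc_bdd_cst|apply/funext => x; rewrite big_nil].
have [Pj|Pj] := boolP (P j).
  rewrite (_ : (fun x => _) = fun x => F j x + \sum_(j <- s | P j) F j x).
    exact: loc_bdd_add.
  by apply/funext => x; rewrite big_cons Pj.
by rewrite (_ : (fun x => _) = fun x => \sum_(j <- s | P j) F j x)//; apply/funext => x; rewrite big_cons (negbTE Pj).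
Qed.

Lemma loc_bdd_prod (J : Type) (s : seq J) (F : J -> 'rV[R]_n -> R) :
  (forall j, loc_bdd (F j)) -> loc_bdd (fun x => \prod_(j <- s) F j x).
Proof.
move=> bF; elim: s => [|j s IH].
  by rewrite (_ : (fun x => _) = fun=> 1); [exact: loc_bdd_cst|apply/funext => x; rewrite big_nil].
rewrite (_ : (fun x => _) = fun x => F j x * \prod_(j <- s) F j x).
  exact: loc_bdd_mul.
by apply/funext => x; rewrite big_cons.
Qed.

Lemma loc_bdd_det k (A : 'rV[R]_n -> 'M[R]_k) : (forall i j, loc_bdd (fun x => A x i j)) ->
  loc_bdd (fun x => \det (A x)).
Proof.
move=> bA; rewrite /determinant; apply: loc_bdd_sum => s.
by apply: loc_bdd_mul; [exact: loc_bdd_cst|apply: loc_bdd_prod => i; exact: bA].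
Qed.

Lemma loc_bdd_integrable f : loc_bdd f -> bdd_supp f ->
  (leb n).-integrable setT (EFin \o f : T -> \bar R).
Proof.
move=> [mf fM] [r fr]; have [M fMr] := fM r.
apply: (@integrable_bounded _ _ _ `|M| r) => // x.
have [xr|xr] := leP `|x| r; last by rewrite fr// normr0.
by rewrite (le_trans (fMr x xr))// ler_norm.
Qed.

Lemma Rintegral_sum (J : Type) (s : seq J) (F : J -> 'rV[R]_n -> R) :
  (forall j, (leb n).-integrable setT (EFin \o F j : T -> \bar R)) ->
  \int[leb n]_x (\sum_(j <- s) F j x) = \sum_(j <- s) \int[leb n]_x F j x.
Proof.
move=> Fi; rewrite /Rintegral; under eq_integral do rewrite -sumEFin.
rewrite integral_sum// -sum_fine// => j _.
exact: integrable_fin_num (Fi j).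
Qed.

Lemma Rintegral_dx w j : loc_lip w -> bdd_supp w -> \int[leb n]_x dx w j x = 0.
Proof. by move=> wL ws; rewrite /Rintegral integral_derive0. Qed.

Lemma by_parts f g j : loc_lip f -> loc_lip g -> bdd_supp g ->
  \int[leb n]_x (dx f j x * g x) = - \int[leb n]_x (f x * dx g j x).
Proof.
move=> fL gL gs; have [r gr] := gs.
have sfg : bdd_supp (fun x => f x * g x) by exists r => x xr; rewrite gr// mulr0.
have := Rintegral_dx j (loc_lip_mul fL gL) sfg.
rewrite (Rintegral_negligible (dxM j fL gL)) RintegralD//.
- move=> /eqP; rewrite addrC addr_eq0 => /eqP <-.
  by apply: eq_Rintegral => x _; rewrite mulrC.
- apply: loc_bdd_integrable; first by apply: loc_bdd_mul; [exact: loc_lip_loc_bdd|exact: loc_bdd_dx].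
  by exists r => x xr; rewrite (dx_out _ gr)// mulr0.
- apply: loc_bdd_integrable; first by apply: loc_bdd_mul; [exact: loc_lip_loc_bdd|exact: loc_bdd_dx].
  by exists r => x xr; rewrite gr// mul0r.
Qed.

End calculus.

(** * Jacobians of locally Lipschitz maps are null Lagrangians *)

Section expo.
Context {R : realType} {n : nat}.
Implicit Types (f g : 'rV[R]_n -> R) (k x v : 'rV[R]_n).

Definition rdot k x : R := \sum_j k 0 j * x 0 j.
Definition expo k x : R := expR (rdot k x).

Lemma rdotDr k x y : rdot k (x + y) = rdot k x + rdot k y.
Proof. by rewrite /rdot -big_split/=; apply: eq_bigr => j _; rewrite mxE mulrDr. Qed.

Lemma rdotDl k l x : rdot (k + l) x = rdot k x + rdot l x.
Proof. by rewrite /rdot -big_split/=; apply: eq_bigr => j _; rewrite mxE mulrDl. Qed.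

Lemma rdotZr k x (s : R) : rdot k (s *: x) = s * rdot k x.
Proof. by rewrite /rdot mulr_sumr; apply: eq_bigr => j _; rewrite mxE mulrCA. Qed.

Lemma rdot_ev k j : rdot k (ev R j) = k 0 j.
Proof.
rewrite /rdot (bigD1 j)//= big1 ?addr0; last first.
  by move=> i ij; rewrite mxE eqxx/= (negbTE ij) mulr0.
by rewrite mxE !eqxx mulr1.
Qed.

Lemma rdot_le k x : `|rdot k x| <= (\sum_j `|k 0 j|) * `|x|.
Proof.
rewrite /rdot (le_trans (ler_norm_sum _ _ _))// mulr_suml ler_sum// => j _.
by rewrite normrM ler_wpM2l// rV_coord_le.
Qed.

Lemma expoD k l x : expo (k + l) x = expo k x * expo l x.
Proof. by rewrite /expo rdotDl expRD. Qed.

Lemma is_derive_line f x v (d : R) :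
  is_derive (0 : R) 1 (fun s : R => f (s *: v + x)) d -> is_derive x v f d.
Proof.
have E : (fun h : R => h^-1 *: (((fun s : R => f (s *: v + x)) \o shift 0) (h *: 1) - f (0 *: v + x)))
   = (fun h => h^-1 *: ((f \o shift x) (h *: v) - f x)).
  by apply/funext => h /=; rewrite [h *: 1]mulr1 addr0 scale0r add0r.
move=> [d1 d2]; split; first by move: d1; rewrite /derivable E.
by move: d2; rewrite /derive E.
Qed.

Lemma is_derive_expo k x j : is_derive x (ev R j) (expo k) (k 0 j * expo k x).
Proof.
apply: is_derive_line.
rewrite (_ : (fun s : R => _) = fun s => expR (s * k 0 j + rdot k x)); last first.
  by apply/funext => s; rewrite /expo rdotDr rdotZr rdot_ev.
have : is_derive (0 : R) 1 (fun s : R => s * k 0 j + rdot k x) (k 0 j).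
  rewrite -[X in is_derive _ _ _ X]addr0.
  apply: is_deriveD.
  rewrite (_ : (fun s : R => _) = (k 0 j) *: id); last first.
    by apply/funext => s /=; rewrite mulrC.
  rewrite -[X in is_derive _ _ _ X]mulr1; exact: is_deriveZ.
move=> h; have := @is_derive1_comp _ expR _ 0 _ _ (is_derive_expR _) h.
by rewrite mul0r add0r mulrC.
Qed.

Lemma dx_expo k x j : dx (expo k) j x = k 0 j * expo k x.
Proof. exact: (@derive_val _ _ _ _ _ _ _ (is_derive_expo k x j)). Qed.

Lemma expR_lip (a b C : R) : a <= C -> b <= C -> `|expR a - expR b| <= expR C * `|a - b|.
Proof.
suff H (x y : R) : y <= C -> expR y - expR x <= expR C * `|x - y|.
  by move=> aC bC; rewrite ler_norml lerNl opprB H//= distrC H.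
move=> yC.
have -> : expR y - expR x = expR y * (1 - expR (x - y)).
  by rewrite mulrBr mulr1 -expRD (_ : y + (x - y) = x)//; ring.
have h : 1 - expR (x - y) <= `|x - y|.
  have := expR_ge1Dx (x - y); have := ler_norm (y - x); rewrite distrC; lra.
apply: (@le_trans _ _ (expR y * `|x - y|)); first by rewrite ler_wpM2l// expR_ge0.
by rewrite ler_wpM2r// ler_expR.
Qed.

Lemma loc_lip_expo k : loc_lip (expo k).
Proof.
move=> r; pose K := \sum_j `|k 0 j|.
exists (expR (K * r) * K) => x y xr yr.
have K0 : 0 <= K by apply: sumr_ge0.
have h z : `|z| <= r -> rdot k z <= K * r.
  by move=> zr; rewrite (le_trans (ler_norm _))// (le_trans (rdot_le _ _))// ler_wpM2l.
rewrite (le_trans (expR_lip (h _ xr) (h _ yr)))// -mulrA ler_wpM2l ?expR_ge0//.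
rewrite -[- rdot k y]mulN1r -rdotZr -rdotDr scaleN1r; exact: rdot_le.
Qed.

Inductive espan : ('rV[R]_n -> R) -> Prop :=
| espan0 : espan (fun=> 0)
| espanE k : espan (expo k)
| espanL (c : R) f g : espan f -> espan g -> espan (fun x => c * f x + g x).

Lemma espan_loc_lip f : espan f -> loc_lip f.
Proof.
elim=> [|k|c g h _ Lg _ Lh]; [exact: loc_lip_cst|exact: loc_lip_expo|].
by apply: loc_lip_add => //; exact: loc_lip_scale.
Qed.

Lemma espan_derivable f x j : espan f -> derivable f x (ev R j).
Proof.
elim=> [|k|c g h _ dg _ dh]; first exact: derivable_cst.
  by have [] := is_derive_expo k x j.
exact: (derivableD (derivableZ (k := c) dg) dh).
Qed.

Lemma espanZ (c : R) f : espan f -> espan (fun x => c * f x).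
Proof.
move=> sf; rewrite (_ : (fun x => _) = fun x => c * f x + (fun=> 0) x).
  by apply: espanL => //; exact: espan0.
by apply/funext => x; rewrite addr0.
Qed.

Lemma espanD f g : espan f -> espan g -> espan (fun x => f x + g x).
Proof.
move=> sf sg; rewrite (_ : (fun x => _) = fun x => 1 * f x + g x); first exact: espanL.
by apply/funext => x; rewrite mul1r.
Qed.

Lemma espan_cst (c : R) : espan (fun=> c).
Proof.
rewrite (_ : (fun=> c) = fun x => c * expo 0 x); first exact/espanZ/espanE.
by apply/funext => x; rewrite /expo /rdot big1 ?expR0 ?mulr1// => j _; rewrite mxE mul0r.
Qed.

(** A product of two exponentials is an exponential, so polynomials in the [expR] of the coordinates
    stay in the span; this is what admits Bernstein polynomials. *)
Lemma espanM f g : espan f -> espan g -> espan (fun x => f x * g x).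
Proof.
move=> sf sg; elim: sf => [|k|c f1 f2 _ s1 _ s2].
- by rewrite (_ : (fun x => _) = fun=> 0); [exact: espan0|apply/funext => x; rewrite mul0r].
- elim: sg => [|l|c g1 g2 _ s1 _ s2].
  + by rewrite (_ : (fun x => _) = fun=> 0); [exact: espan0|apply/funext => x; rewrite mulr0].
  + rewrite (_ : (fun x => _) = expo (k + l)); first exact: espanE.
    by apply/funext => x; rewrite expoD.
  + rewrite (_ : (fun x => _) = fun x => c * (expo k x * g1 x) + expo k x * g2 x); first exact: espanL.
    by apply/funext => x; ring.
- rewrite (_ : (fun x => _) = fun x => c * (f1 x * g x) + f2 x * g x); first exact: espanL.
  by apply/funext => x; ring.
Qed.

End expo.

Section null_lagrangian.
Context {R : realType} {m : nat}.
Implicit Types (f g : 'rV[R]_m -> R) (u : 'I_m -> 'rV[R]_m -> R) (x : 'rV[R]_m).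
Let T := bor R m.

Definition gradm u x : 'M[R]_m := \matrix_(i, j) dx (u i) j x.

Definition upd u i f : 'I_m -> 'rV[R]_m -> R := fun k => if k == i then f else u k.

Lemma upd_id u i : upd u i (u i) = u.
Proof. by apply/funext => k; rewrite /upd; case: eqP => [->|]. Qed.

Lemma det_gradm_upd u i f x :
  \det (gradm (upd u i f) x) = \sum_j dx f j x * cofactor (gradm u x) i j.
Proof.
rewrite (expand_det_row _ i); apply: eq_bigr => j _; rewrite mxE /upd eqxx; congr (_ * _).
rewrite /cofactor; congr (_ * \det _); apply/matrixP => k l; rewrite !mxE.
by rewrite eq_sym (negbTE (neq_lift _ _)).
Qed.

Lemma loc_bdd_cofactor u i j : (forall k, loc_lip (u k)) -> loc_bdd (fun x => cofactor (gradm u x) i j).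
Proof.
move=> uL; rewrite /cofactor; apply: loc_bdd_mul; first exact: loc_bdd_cst.
apply: loc_bdd_det => k l; rewrite (_ : (fun x => _) = dx (u (lift i k)) (lift j l)).
  exact: loc_bdd_dx.
by apply/funext => x; rewrite !mxE.
Qed.

Lemma loc_bdd_det_gradm u : (forall k, loc_lip (u k)) -> loc_bdd (fun x => \det (gradm u x)).
Proof.
move=> uL; apply: loc_bdd_det => k l; rewrite (_ : (fun x => _) = dx (u k) l).
  exact: loc_bdd_dx.
by apply/funext => x; rewrite !mxE.
Qed.

Lemma det_row0 k (A : 'M[R]_k) i : (forall j, A i j = 0) -> \det A = 0.
Proof. by move=> A0; rewrite (expand_det_row _ i) big1// => j _; rewrite A0 mul0r. Qed.

Lemma det_gradm_out u i0 (r : R) x : (forall y, r < `|y| -> u i0 y = 0) ->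
  r < `|x| -> \det (gradm u x) = 0.
Proof. by move=> ur xr; apply: (@det_row0 _ _ i0) => j; rewrite mxE (dx_out _ ur). Qed.

(** Row [i0] survives in every minor that deletes another row. Hence a function placed in row [i]
    needs no bounded support of its own. *)
Lemma cofactor_out u i i0 j (r : R) x : i != i0 -> (forall y, r < `|y| -> u i0 y = 0) ->
  r < `|x| -> cofactor (gradm u x) i j = 0.
Proof.
move=> ii0 ur xr; rewrite /cofactor.
have [k kE _] := unlift_some ii0.
by rewrite (@det_row0 _ _ k) ?mulr0// => l; rewrite !mxE -kE (dx_out _ ur).
Qed.

Lemma Rintegral_det_upd u i i0 f : i != i0 -> (forall k, loc_lip (u k)) -> bdd_supp (u i0) ->
  loc_lip f ->
  \int[leb m]_x \det (gradm (upd u i f) x) =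
  \sum_j \int[leb m]_x (dx f j x * cofactor (gradm u x) i j).
Proof.
move=> ii0 uL [r ur] fL.
rewrite -Rintegral_sum.
  by apply: eq_Rintegral => x _; rewrite det_gradm_upd.
move=> j; apply: loc_bdd_integrable; first by apply: loc_bdd_mul; [exact: loc_bdd_dx|exact: loc_bdd_cofactor].
by exists r => x xr; rewrite (cofactor_out _ ii0 ur)// mulr0.
Qed.

Lemma det_expo u i0 : loc_lip (u i0) -> bdd_supp (u i0) ->
  (forall i, i != i0 -> exists k, u i = expo k) ->
  \int[leb m]_x \det (gradm u x) = 0.
Proof.
move=> uL us uE.
(* The value at [i0] is irrelevant: every use below is guarded by a test against [i0]. *)
pose kap i : 'rV[R]_m := if pselect (exists k, u i = expo k) is left h then projT1 (cid h) else 0.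
have kapE i : i != i0 -> u i = expo (kap i).
  move=> ii0; rewrite /kap; case: pselect => [h|]; first by case: (cid h).
  by move=> []; exact: uE.
pose d x : 'rV[R]_m := \row_i (if i == i0 then 1 else expo (kap i) x).
pose K (v : 'rV[R]_m) : 'M[R]_m := \matrix_(i, j) (if i == i0 then v 0 j else kap i 0 j).
pose ks : 'rV[R]_m := \sum_(i | i != i0) kap i.
pose phi := u i0.
have detE x : \det (gradm u x) = expo ks x * \det (K (\row_j dx phi j x)).
  have -> : gradm u x = diag_mx (d x) *m K (\row_j dx phi j x).
    apply/matrixP => i j; rewrite mul_diag_mx !mxE.
    case: eqP => [->|/eqP ii0]; first by rewrite mul1r.
    by rewrite (kapE i ii0) dx_expo mulrC.
  rewrite det_mulmx det_diag; congr (_ * _).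
  rewrite (bigD1 i0)//= mxE eqxx mul1r /expo.
  rewrite (_ : rdot ks x = \sum_(i | i != i0) rdot (kap i) x).
    by rewrite expR_sum; apply: eq_bigr => i ii0; rewrite mxE (negbTE ii0).
  rewrite exchange_big/=; apply: eq_bigr => j _; rewrite summxE mulr_suml.
  by apply: eq_bigr.
pose c j := cofactor (K 0) i0 j.
have KE v j : cofactor (K v) i0 j = c j.
  rewrite /c /cofactor; congr (_ * \det _); apply/matrixP => k l; rewrite !mxE.
  by rewrite eq_sym (negbTE (neq_lift _ _)).
have Kdet v : \det (K v) = \sum_j v 0 j * c j.
  by rewrite (expand_det_row _ i0); apply: eq_bigr => j _; rewrite KE mxE eqxx.
(* Each [kap i] is a row of [K 0] other than row [i0], and [c] consists of the cofactors of row
   [i0]; their pairing is an off-diagonal entry of [K 0] times its adjugate. *)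
have ksc : \sum_j ks 0 j * c j = 0.
  rewrite /ks; under eq_bigr do rewrite summxE mulr_suml.
  rewrite exchange_big/= big1// => i ii0.
  have E : \sum_j K 0 i j * (\adj (K 0)) j i0 = 0.
    have := congr1 (fun A : 'M[R]_m => A i i0) (mul_mx_adj (K 0)).
    by rewrite [X in X = _ -> _]mxE [X in _ = X -> _]mxE (negbTE ii0) mulr0n.
  rewrite -[RHS]E; apply: eq_bigr => j _.
  by rewrite !mxE (negbTE ii0).
have ksL := loc_lip_expo ks.
pose w x := phi x * expo ks x.
have wL : loc_lip w by exact: loc_lip_mul.
have ws : bdd_supp w by exact: bdd_supp_mull.
have [r phir] := us.
have pwi : (leb m).-integrable setT (EFin \o w : T -> \bar R).
  by apply: loc_bdd_integrable => //; exact: loc_lip_loc_bdd.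
have dwi j : (leb m).-integrable setT (EFin \o dx w j : T -> \bar R).
  apply: loc_bdd_integrable; first exact: loc_bdd_dx.
  have [s wr] := ws; exists s => x xs; exact: (dx_out _ wr).
(* The product rule for [w] produces the wanted determinant plus the subtracted term; that term
   vanishes by [ksc], and a combination of derivatives of [w] remains. *)
transitivity (\int[leb m]_x (\sum_j c j * dx w j x - (\sum_j ks 0 j * c j) * w x)).
  apply: Rintegral_negligible.
  apply: negligibleS (negligible_forall (fun j => dxM j uL ksL)) => x /= h.
  apply: contrapT => /forallNP nd; apply: h.
  rewrite detE Kdet mulr_sumr mulr_suml -sumrB; apply: eq_bigr => j _.
  have /contrapT -> := nd j; rewrite mxE dx_expo /w /phi; ring.
rewrite ksc; under eq_Rintegral do rewrite mul0r subr0.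
rewrite Rintegral_sum; last by move=> j; exact: (integrableZl measurableT (c j) (dwi j)).
by apply: big1 => j _; rewrite RintegralZl// Rintegral_dx// mulr0.
Qed.

Lemma det_espan u i i0 : i != i0 -> (forall k, loc_lip (u k)) -> bdd_supp (u i0) ->
  (forall k, \int[leb m]_x \det (gradm (upd u i (expo k)) x) = 0) ->
  forall f, espan f -> \int[leb m]_x \det (gradm (upd u i f) x) = 0.
Proof.
move=> ii0 uL us H f; elim=> [|k|c g h sg IHg sh IHh]; last first.
- have [gL hL] := (espan_loc_lip sg, espan_loc_lip sh).
  have [r ur] := us.
  have ci g' j : loc_lip g' -> (leb m).-integrable setT (EFin \o (fun x => dx g' j x * cofactor (gradm u x) i j) : T -> \bar R).
    move=> g'L; apply: loc_bdd_integrable; first by apply: loc_bdd_mul; [exact: loc_bdd_dx|exact: loc_bdd_cofactor].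
    by exists r => x xr; rewrite (cofactor_out _ ii0 ur)// mulr0.
  have fL : loc_lip (fun x => c * g x + h x) by apply: loc_lip_add => //; exact: loc_lip_scale.
  move: IHg IHh; rewrite (Rintegral_det_upd ii0 uL us gL) (Rintegral_det_upd ii0 uL us hL).
  rewrite (Rintegral_det_upd ii0 uL us fL) => IHg IHh.
  set S1 := (X in X = 0) in IHg; set S2 := (X in X = 0) in IHh.
  apply: (@eq_trans _ _ (c * S1 + S2)); last by rewrite IHg IHh mulr0 addr0.
  rewrite /S1 /S2 mulr_sumr -big_split/=.
  apply: eq_bigr => j _; rewrite -RintegralZl//; last exact: ci.
  rewrite -RintegralD//; [|by have := integrableZl measurableT c (ci _ j gL)|exact: ci].
  apply: eq_Rintegral => x _; rewrite mulrA -mulrDl; congr (_ * _).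
  have dg := @espan_derivable _ _ _ x j sg; have dh := @espan_derivable _ _ _ x j sh.
  by rewrite /dx (deriveD (derivableZ (k := c) dg) dh) (deriveZ c dg).
- exact: H.
- rewrite (Rintegral_det_upd ii0 uL us (loc_lip_cst 0)) big1// => j _.
  by rewrite /Rintegral integral0_eq// => x _; rewrite /dx derive_cst mul0r.
Qed.

End null_lagrangian.

(** * Bernstein polynomials as expectations *)

Section bernstein.
Context {R : realType} {n : nat}.
Implicit Types (v : 'rV[R]_n -> R) (th : 'I_n -> R) (y x : 'rV[R]_n) (l : seq 'I_n).

(** When each [th i] lies in [0, 1], this is the expectation of [v] at the end of a random walk from
    [y]: each entry [i] of the list independently adds [delta] in direction [i] with probability
    [th i]. If every index occurs [k] times it is a Bernstein polynomial of degree [k] in each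
    [th i], without binomial coefficients. *)
Fixpoint bern v (delta : R) th l y : R :=
  match l with
  | [::] => v y
  | i :: l' => (1 - th i) * bern v delta th l' y +
               th i * bern v delta th l' (y + delta *: ev R i)
  end.

Lemma bernN v delta th l y : bern (fun y => - v y) delta th l y = - bern v delta th l y.
Proof. by elim: l y => //= i l IH y; rewrite !IH; ring. Qed.

Lemma bern_lip v (L delta : R) th l y z : (forall i, 0 <= th i <= 1) ->
  (forall y z, `|v y - v z| <= L * `|y - z|) ->
  `|bern v delta th l y - bern v delta th l z| <= L * `|y - z|.
Proof.
move=> th01 vL; elim: l y z => [|i l IH] y z /=; first exact: vL.
have /andP[t0 t1] := th01 i.
have E (a b c d : R) : (1 - th i) * a + th i * b - ((1 - th i) * c + th i * d)
  = (1 - th i) * (a - c) + th i * (b - d) by ring.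
rewrite E (le_trans (ler_normD _ _))// !normrM.
rewrite (ger0_norm t0) (@ger0_norm _ (1 - th i)) ?subr_ge0//.
have -> : L * `|y - z| = (1 - th i) * (L * `|y - z|) + th i * (L * `|y - z|) by ring.
rewrite lerD// ler_wpM2l ?subr_ge0//.
by rewrite (le_trans (IH _ _))// opprD addrACA subrr addr0.
Qed.

Lemma norm_ev (i : 'I_n) : `|ev R i| <= 1.
Proof.
rewrite rV_norm_le ler01; apply/forallP => j; rewrite mxE eqxx/=.
by case: (j == i); rewrite ?normr1 ?normr0.
Qed.

Lemma bern_espan v (delta : R) (th : 'rV[R]_n -> 'I_n -> R) l y :
  (forall i, espan (fun x => th x i)) -> espan (fun x => bern v delta (th x) l y).
Proof.
move=> sth; elim: l y => [|i l IH] y /=; first exact: espan_cst.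
rewrite (_ : (fun x => _) = (fun x => (1 + (-1) * th x i) * bern v delta (th x) l y +
  th x i * bern v delta (th x) l (y + delta *: ev R i))); last first.
  by apply/funext => x; rewrite mulN1r.
apply: espanD; apply: espanM => //.
apply: espanD; first exact: espan_cst.
exact: espanZ.
Qed.

(** Differentiating the probability of one step yields the difference of two averages started
    [delta] apart, at most [L * delta]. Only the occurrences of [j] contribute, so the bound is
    independent of the degree once [delta] is inverse to it. *)
Lemma bern_dx v (L delta D : R) (th : 'rV[R]_n -> 'I_n -> R) l y x j :
  0 <= delta -> 0 <= L -> (forall i, espan (fun x => th x i)) ->
  (forall i, 0 <= th x i <= 1) ->
  (forall y z, `|v y - v z| <= L * `|y - z|) ->
  (forall i, `|dx (fun x => th x i) j x| <= D * (i == j)%:R) ->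
  `|dx (fun x => bern v delta (th x) l y) j x| <= (count_mem j l)%:R * (D * (L * delta)).
Proof.
move=> d0 L0 sth th01 vL dth.
elim: l y => [|i l IH] y /=; first by rewrite /dx derive_cst normr0 mul0r.
pose A y x := bern v delta (th x) l y.
have dA y' : derivable (A y') x (ev R j) by apply: espan_derivable; exact: bern_espan.
have dt : derivable (fun x => th x i) x (ev R j) by exact: espan_derivable.
have -> : dx (fun x => (1 - th x i) * A y x + th x i * A (y + delta *: ev R i) x) j x =
  (1 - th x i) * dx (A y) j x + th x i * dx (A (y + delta *: ev R i)) j x
   + dx (fun x => th x i) j x * (A (y + delta *: ev R i) x - A y x).
  have d1 : derivable (cst 1 - (fun x => th x i)) x (ev R j).
    exact: (derivableB (derivable_cst _ _ _) dt).
  have := deriveD (derivableM d1 (dA y)) (derivableM dt (dA (y + delta *: ev R i))).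
  rewrite (deriveM d1 (dA y)) (deriveM dt (dA (y + delta *: ev R i))).
  rewrite (deriveB (derivable_cst _ _ _) dt) derive_cst sub0r.
  rewrite /dx => ->; rewrite /GRing.scale/= !fctE; ring.
have /andP[t0 t1] := th01 i.
rewrite (le_trans (ler_normD _ _))// natrD [leRHS]mulrDl [leRHS]addrC lerD//.
  rewrite (le_trans (ler_normD _ _))// !normrM.
  rewrite (ger0_norm t0) (@ger0_norm _ (1 - th x i)) ?subr_ge0//.
  have h1 := ler_wpM2l (_ : 0 <= 1 - th x i) (IH y).
  have h2 := ler_wpM2l t0 (IH (y + delta *: ev R i)).
  have {}h1 : (1 - th x i) * `|dx (A y) j x| <= (1 - th x i) * ((count_mem j l)%:R * (D * (L * delta))).
    by apply: h1; rewrite subr_ge0.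
  apply: (le_trans (lerD h1 h2)); rewrite -mulrDl subrK mul1r; exact: lexx.
rewrite normrM mulrA (mulrC (_%:R)) ler_pM//.
rewrite distrC (le_trans (bern_lip _ _ _ _ _ vL))// ler_wpM2l//.
rewrite opprD addrA subrr sub0r normrN normrZ ger0_norm//.
by rewrite ler_piMr// norm_ev.
Qed.

(** Chebyshev's argument: the sup norm is at most the sum of the coordinates, each [|t|] is at most
    [eta + t ^+ 2 / eta], and the mean square of a coordinate of the walk minus [c] is squared bias
    plus binomial variance. *)
Lemma bern_le v (L delta eta : R) th l y c : 0 < eta -> 0 <= L ->
  (forall i, 0 <= th i <= 1) ->
  (forall y z, `|v y - v z| <= L * `|y - z|) ->
  bern v delta th l y <= v c + L * \sum_j (eta +
    ((y 0 j + (count_mem j l)%:R * delta * th j - c 0 j) ^+ 2 +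
      (count_mem j l)%:R * (th j * (1 - th j)) * delta ^+ 2) / eta).
Proof.
move=> eta0 L0 th01 vL; elim: l y => [|i l IH] y /=.
  rewrite -lerBlDl (le_trans (ler_norm _))// (le_trans (vL _ _))// ler_wpM2l//.
  rewrite rV_norm_le sumr_ge0/=; last first.
    by move=> j _; rewrite !mul0r !addr0 addr_ge0 ?(ltW eta0)// divr_ge0 ?sqr_ge0// ltW.
  apply/forallP => j; rewrite (bigD1 j)//= !mul0r !addr0 !mxE ler_wpDr//.
    apply: sumr_ge0 => k _; rewrite !mul0r !addr0.
    by rewrite addr_ge0 ?(ltW eta0)// divr_ge0 ?sqr_ge0// ltW.
  set t := y 0 j - c 0 j.
  rewrite -(ler_pM2r eta0) mulrDl divfK ?gt_eqF// -(real_normK (num_real t)).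
  have := normr_ge0 t; move: `|t| => s s0; nra.
have /andP[t0 t1] := th01 i.
have t1' : 0 <= 1 - th i by rewrite subr_ge0.
have h1 := ler_wpM2l t1' (IH y).
have h2 := ler_wpM2l t0 (IH (y + delta *: ev R i)).
apply: (le_trans (lerD h1 h2)).
rewrite !mulrDr addrACA -mulrDl subrK mul1r lerD2l.
rewrite mulrCA (mulrCA (th i)) -mulrDr ler_wpM2l// !mulr_sumr -big_split/= ler_sum// => j _.
rewrite !mxE eqxx/=; case: (eqVneq j i) => [->|ji]; last first.
  have ij : (i == j) = false by rewrite eq_sym (negbTE ji).
  rewrite ?ij ?(negbTE ji) /= mulr0 addr0 add0n.
  by rewrite -mulrDl subrK mul1r.
rewrite ?eqxx/= ?mulr1 natrD.
(* An exact identity: averaging over one more step shifts the mean by [delta * th i] and adds the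
   variance [th i * (1 - th i) * delta ^+ 2]. *)
move: (count_mem i l)%:R => k; rewrite le_eqVlt; apply/orP; left; apply/eqP.
by field; rewrite gt_eqF.
Qed.

End bernstein.

Section approx.
Context {R : realType}.

Lemma rV_norm_leI n (v : 'rV[R]_n) (r : R) : 0 <= r -> (forall j, `|v 0 j| <= r) -> `|v| <= r.
Proof. by move=> r0 h; rewrite rV_norm_le r0; apply/forallP. Qed.

Lemma ln_lip (a b : R) : 1 <= a -> 1 <= b -> `|ln a - ln b| <= `|a - b|.
Proof.
wlog ab : a b / b <= a => [H a1 b1|a1 b1].
  have [ba|/ltW ab] := leP b a; first exact: H.
  by rewrite distrC (distrC a); exact: H.
have a0 : 0 < a by exact: lt_le_trans a1.
have b0 : 0 < b by exact: lt_le_trans b1.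
have lb0 : 0 <= ln b by rewrite ln_ge0.
have lab : ln b <= ln a by rewrite ler_ln ?posrE.
rewrite !ger0_norm ?subr_ge0//.
have h := expR_ge1Dx (ln a - ln b).
have e : a = b * expR (ln a - ln b) by rewrite expRB !lnK ?posrE// mulrC divfK ?gt_eqF.
rewrite [X in _ <= X - _]e; nra.
Qed.

Lemma count_rep n (k : nat) (j : 'I_n) :
  count_mem j (flatten (nseq k (enum 'I_n))) = k.
Proof.
elim: k => [//|k IH] /=; rewrite count_cat IH count_uniq_mem ?enum_uniq//.
by rewrite mem_enum add1n.
Qed.

Lemma espan_approx n (f : 'rV[R]_n -> R) (r : R) : loc_lip f -> 0 < r ->
  exists h : nat -> 'rV[R]_n -> R, exists M : R,
  [/\ forall k, espan (h k),
     forall k x j, `|x| < r -> `|dx (h k) j x| <= M &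
     forall e, 0 < e -> exists k0 : nat, forall k x, (k0 <= k)%N -> `|x| <= r -> `|h k x - f x| <= e].
Proof.
move=> fL r0; have [L0 fLr] := fL r.
(* The substitution [y_j = expR (x_j + r)] sends the ball into the cube with sides [1, [Mx]]. There
   [ln] is 1-Lipschitz, so [f] read in [y] and clamped keeps its constant and becomes globally
   Lipschitz. *)
pose Mx := expR (r + r).
have Mx1 : 1 < Mx by rewrite /Mx -[X in X < _](@expR0 R) ltr_expR; lra.
have M10 : 0 < Mx - 1 by rewrite subr_gt0.
pose cl t : R := Num.max 1 (Num.min t Mx).
have cl1 t : 1 <= cl t by rewrite le_max lexx.
have clM t : cl t <= Mx by rewrite ge_max (ltW Mx1)/= ge_min lexx orbT.
pose xy (y : 'rV[R]_n) : 'rV[R]_n := \row_j (ln (cl (y 0 j)) - r).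
have xyr y : `|xy y| <= r.
  apply: rV_norm_leI => [|j]; rewrite ?(ltW r0)// mxE ler_norml.
  have h1 : 0 <= ln (cl (y 0 j)) by rewrite ln_ge0.
  have h2 : ln (cl (y 0 j)) <= r + r.
    by rewrite -[X in _ <= X]expRK ler_ln ?posrE ?expR_gt0// (lt_le_trans ltr01).
  by apply/andP; split; lra.
pose L := `|L0|.
have L_ge0 : 0 <= L by exact: normr_ge0.
pose v y := f (xy y).
have vL y z : `|v y - v z| <= L * `|y - z|.
  rewrite (le_trans (fLr _ _ (xyr y) (xyr z)))//.
  apply: (@le_trans _ _ (L * `|xy y - xy z|)); first by rewrite ler_wpM2r// ler_norm.
  rewrite ler_wpM2l//; apply: rV_norm_leI => // j; rewrite !mxE.
  rewrite (_ : _ - _ - _ = ln (cl (y 0 j)) - ln (cl (z 0 j))); last by ring.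
  rewrite (le_trans (ln_lip (cl1 _) (cl1 _)))// (le_trans (clamp_lip _ _ _ _))//.
  have := rV_coord_le (y - z) j; by rewrite !mxE.
(* The position of [y_j] in [1, [Mx]], scaled to a probability on the ball; it is an exponential
   plus a constant, hence in the span. *)
pose th (x : 'rV[R]_n) (i : 'I_n) : R := (expR (x 0 i + r) - 1) / (Mx - 1).
pose D := Mx / (Mx - 1).
have thE i : (fun x => th x i) = (fun x => (expR r / (Mx - 1)) * expo (ev R i) x + (- (Mx - 1)^-1)).
  apply/funext => x; rewrite /th expRD /expo.
  have -> : rdot (ev R i) x = x 0 i.
    rewrite /rdot (bigD1 i)//= big1 ?addr0 ?mxE ?eqxx ?mul1r// => j ji.
    by rewrite mxE (negbTE ji) andbF mul0r.
  by field; rewrite gt_eqF.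
have sth i : espan (fun x => th x i).
  by rewrite thE; apply: espanL; [exact: espanE|exact: espan_cst].
have th01 x : `|x| <= r -> forall i, 0 <= th x i <= 1.
  move=> xr i; have := le_trans (rV_coord_le x i) xr; rewrite ler_norml => /andP[x1 x2].
  rewrite /th divr_ge0 ?(ltW M10)//=; last first.
    by rewrite subr_ge0 -[X in X <= _](@expR0 R) ler_expR; lra.
  rewrite ler_pdivrMr// mul1r lerD2r ler_expR; lra.
have dth x j : `|x| < r -> forall i, `|dx (fun x => th x i) j x| <= D * (i == j)%:R.
  move=> xr i; rewrite thE.
  have d1 : derivable (fun x => expR r / (Mx - 1) * expo (ev R i) x) x (ev R j).
    by apply: espan_derivable; apply: espanZ; exact: espanE.
  have d2 : derivable (expo (ev R i)) x (ev R j) by apply: espan_derivable; exact: espanE.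
  rewrite /dx (deriveD d1 (derivable_cst _ _ _)) (deriveZ _ d2) derive_cst addr0.
  have := dx_expo (ev R i) x j; rewrite /dx => ->.
  rewrite mxE eqxx /= eq_sym; case: (eqVneq i j) => [->|ij].
    rewrite mul1r mulr1 /D /GRing.scale/=.
    have -> : expo (ev R j) x = expR (x 0 j).
      rewrite /expo /rdot (bigD1 j)//= big1 ?addr0 ?mxE ?eqxx ?mul1r// => k kj.
      by rewrite mxE (negbTE kj) andbF mul0r.
    rewrite mulrAC -expRD ger0_norm ?divr_ge0 ?expR_ge0 ?(ltW M10)//.
    rewrite ler_pM2r ?invr_gt0// ler_expR.
    have := le_lt_trans (rV_coord_le x j) xr; rewrite ltr_norml => /andP[_ x2]; lra.
  by rewrite mul0r mulr0 scaler0 normr0.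
pose dl (k : nat) : R := (Mx - 1) / k.+1%:R.
pose l (k : nat) := flatten (nseq k.+1 (enum 'I_n)).
pose y0 : 'rV[R]_n := const_mx 1.
(* [k.+1] steps of length [dl k] cross the whole side [Mx - 1]; this product is the last factor of
   the gradient bound. *)
exists (fun k x => bern v (dl k) (th x) (l k) y0), (D * (L * (Mx - 1))); split.
- by move=> k; exact: bern_espan.
- move=> k x j xr.
  have dl0 : 0 <= dl k by rewrite divr_ge0 ?(ltW M10).
  have := @bern_dx _ _ v L (dl k) D th (l k) y0 x j dl0 (normr_ge0 _) sth (th01 x (ltW xr)) vL (dth x j xr).
  rewrite count_rep; move/le_trans; apply; rewrite le_eqVlt; apply/orP; left; apply/eqP.
  by rewrite /dl; field; rewrite addrC natr1 pnatr_eq0.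
move=> e e0.
pose A := (Mx - 1) ^+ 2.
(* The terms [eta] cost at most [e / 2] in total; the variance terms, of order [A / k.+1], cost at
   most [e / 2] once [k.+1] exceeds [B]. *)
pose eta := e / 2 / (L * n%:R + 1).
have Ln0 : 0 <= L * n%:R by rewrite mulr_ge0.
have eta0 : 0 < eta by rewrite !divr_gt0// ltr_wpDl.
pose B := L * n%:R * A / eta / (e / 2).
exists (Num.bound B) => k x kB xr.
have k10 : k.+1%:R != 0 :> R by rewrite pnatr_eq0.
have kB' : B <= k.+1%:R.
  rewrite (le_trans (ltW (archi_boundP _)))//.
    rewrite /B; apply: divr_ge0; last by rewrite divr_ge0// ltW.
    by apply: divr_ge0; [rewrite mulr_ge0// sqr_ge0|exact: ltW].
  by rewrite ler_nat (leq_trans kB).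
(* [c] is both the point representing [x] and the mean of the walk, so the bias in [bern_le] is zero
   and only the variance remains. *)
pose c : 'rV[R]_n := \row_j expR (x 0 j + r).
have vc : v c = f x.
  rewrite /v; congr f; apply/rowP => j; rewrite !mxE.
  have := le_trans (rV_coord_le x j) xr; rewrite ler_norml => /andP[x1 x2].
  rewrite /cl min_l; last by rewrite ler_expR; lra.
  rewrite max_r; last by rewrite -[X in X <= _](@expR0 R) ler_expR; lra.
  by rewrite expRK addrK.
(* Stated for any [w] so that it applies to [v] and to its opposite, giving both sides of the
   estimate. *)
have key (w : 'rV[R]_n -> R) : (forall y z, `|w y - w z| <= L * `|y - z|) ->
    bern w (dl k) (th x) (l k) y0 <= w c + e.
  move=> wL; rewrite (le_trans (bern_le _ _ _ c eta0 (normr_ge0 L0) (th01 x xr) wL))//.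
  rewrite lerD2l.
  apply: (@le_trans _ _ (L * \sum_(j < n) (eta + A / k.+1%:R / eta))).
    rewrite ler_wpM2l// ler_sum// => j _; rewrite lerD2l ler_pM2r ?invr_gt0//.
    rewrite count_rep !mxE.
    have -> : 1 + k.+1%:R * dl k * th x j - expR (x 0 j + r) = 0.
      rewrite /dl /th; move: k10; move: (k.+1%:R : R) => K K0.
      by field; rewrite K0 gt_eqF.
    rewrite expr0n/= add0r.
    have -> : A / k.+1%:R = k.+1%:R * dl k ^+ 2.
      by rewrite /A /dl; move: k10; move: (k.+1%:R : R) => K K0; field.
    rewrite -mulrA ler_wpM2l// ler_piMl ?sqr_ge0//.
    have /andP[t0 t1] := th01 x xr j; nra.
  rewrite sumr_const card_ord -[_ *+ n]mulr_natr.
  rewrite (_ : L * _ = L * n%:R * eta + (L * n%:R * A / eta) / k.+1%:R); last first.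
    by move: k10; move: (k.+1%:R : R) => K K0; field; rewrite K0 gt_eqF.
  rewrite (splitr e) lerD//.
    have : eta * (L * n%:R + 1) = e / 2 by rewrite /eta divfK// gt_eqF// ltr_wpDl.
    rewrite mulrDr mulr1 => <-; rewrite (mulrC eta) lerDl; exact: ltW.
  by rewrite ler_pdivrMr// [leRHS]mulrC -ler_pdivrMr ?divr_gt0//; exact: kB'.
rewrite ler_norml -vc; apply/andP; split; last by rewrite lerBlDl; exact: key.
rewrite lerBrDl -[X in X <= _]opprK -[leRHS]opprK lerN2 -bernN opprB addrC.
apply: key => y z; rewrite opprK addrC distrC; exact: vL.
Qed.

End approx.

(** * Passing to the limit one row at a time *)

Section closedness.
Context {R : realType} {m : nat}.
Implicit Types (f g : 'rV[R]_m -> R) (u : 'I_m -> 'rV[R]_m -> R) (x : 'rV[R]_m).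
Let T := bor R m.

Lemma le_Rintegral_bound f g (e : R) : loc_bdd f -> bdd_supp f ->
  (leb m).-integrable setT (EFin \o g : T -> \bar R) ->
  (forall x, `|f x| <= e * `|g x|) ->
  `|\int[leb m]_x f x| <= e * \int[leb m]_x `|g x|.
Proof.
move=> bf sf gi fg; have fi := loc_bdd_integrable bf sf.
rewrite (le_trans (le_normr_Rintegral _ fi))// -RintegralZl//; last exact: integrable_norm.
apply: le_Rintegral => //; first exact: integrable_norm.
exact: (integrableZl measurableT e (integrable_norm gi)).
Qed.

(** Against a Lipschitz function, integration by parts leaves [h k - f], which is uniformly small;
    [weak_limit] and the bound [M] extend this to bounded measurable [psi]. *)
Lemma weak_dx (h : nat -> 'rV[R]_m -> R) f (r M : R) j psi :
  (forall k, loc_lip (h k)) -> loc_lip f ->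
  (forall k x, `|x| < r -> `|dx (h k) j x| <= M) ->
  (forall e, 0 < e -> exists k0 : nat, forall k x, (k0 <= k)%N -> `|x| <= r -> `|h k x - f x| <= e) ->
  loc_bdd psi -> (forall x, ~ `|x| < r -> psi x = 0) ->
  \int[leb m]_x ((dx (h k) j x - dx f j x) * psi x) @[k --> \oo] --> 0.
Proof.
move=> hL fL hM hf bpsi psi0.
have spsi : bdd_supp psi by exists r => x xr; apply: psi0; apply/negP; rewrite -leNgt ltW.
have [_ /(_ r) [Mf fM]] := loc_bdd_dx j fL.
apply: (@weak_limit _ _ _ _ _ (fun k x => dx (h k) j x - dx f j x) (M + Mf) r).
- move=> k; apply: measurable_funB; [exact: (loc_bdd_dx j (hL k)).1|exact: (loc_bdd_dx j fL).1].
- move=> k x xr; rewrite (le_trans (ler_normB _ _))// lerD//; first exact: hM.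
  by apply: fM; exact: ltW.
- move=> g gL g0.
  have gout x : r < `|x| -> g x = 0 by move=> xr; apply: g0 => /=; apply/negP; rewrite -leNgt ltW.
  have sg : bdd_supp g by exists r.
  have dgi : (leb m).-integrable setT (EFin \o dx g j : T -> \bar R).
    apply: loc_bdd_integrable; first exact: loc_bdd_dx.
    by exists r => x xr; exact: (dx_out _ gout).
  apply/cvgrPdist_le => e e0.
  set G := \int[leb m]_x `|dx g j x|.
  have G0 : 0 <= G by apply: Rintegral_ge0 => x _.
  have eG : 0 < e / (G + 1) by rewrite divr_gt0// ltr_wpDl.
  have [k0 hk0] := hf _ eG.
  exists k0 => // k /= k0k; rewrite sub0r normrN.
  have hfL : loc_lip (fun x => h k x - f x) by exact: loc_lip_sub.
  have -> : \int[leb m]_x ((dx (h k) j x - dx f j x) * g x) =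
            \int[leb m]_x (dx (fun x => h k x - f x) j x * g x).
    apply: Rintegral_negligible.
    apply: negligibleS (negligibleU (loc_lip_derivable_ae (ev _ j) (hL k)) (loc_lip_derivable_ae (ev _ j) fL)) => x /= ne.
    apply: contrapT => /not_orP[/contrapT dh /contrapT df]; apply: ne.
    by congr (_ * _); rewrite /dx (deriveB dh df).
  rewrite by_parts// normrN.
  apply: (@le_trans _ _ (e / (G + 1) * G)).
    apply: le_Rintegral_bound => //.
    + by apply: loc_bdd_mul; [exact: loc_lip_loc_bdd|exact: loc_bdd_dx].
    + by exists r => x xr; rewrite (dx_out _ gout)// mulr0.
    move=> x; rewrite normrM; have [xr|xr] := leP `|x| r.
      by rewrite ler_wpM2r//; exact: hk0.
    by rewrite (dx_out _ gout)// normr0 !mulr0.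
  rewrite mulrAC ler_pdivrMr ?ltr_wpDl// ler_wpM2l ?lerDl// ltW//.
- exact: loc_bdd_integrable.
- exact: psi0.
Qed.

Lemma det_row_step u i i0 f : i != i0 -> (forall k, loc_lip (u k)) -> bdd_supp (u i0) -> loc_lip f ->
  (forall k, \int[leb m]_x \det (gradm (upd u i (expo k)) x) = 0) ->
  \int[leb m]_x \det (gradm (upd u i f) x) = 0.
Proof.
move=> ii0 uL us fL H; have [r0 ur0] := us.
pose r := `|r0| + 1.
have r_gt0 : 0 < r by rewrite ltr_wpDl.
have r0r : r0 < r by rewrite (le_lt_trans (ler_norm _))// ltrDl.
have [h [M [sh hM hf]]] := espan_approx fL r_gt0.
have hL k := espan_loc_lip (sh k).
pose c j x := cofactor (gradm u x) i j.
have bc j : loc_bdd (c j) by exact: loc_bdd_cofactor.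
have c0 j x : ~ `|x| < r -> c j x = 0.
  move/negP; rewrite -leNgt => xr; apply: (cofactor_out _ ii0 ur0).
  exact: lt_le_trans xr.
have ci g j : loc_lip g -> (leb m).-integrable setT (EFin \o (fun x => dx g j x * c j x) : T -> \bar R).
  move=> gL; apply: loc_bdd_integrable; first by apply: loc_bdd_mul => //; exact: loc_bdd_dx.
  by exists r => x xr; rewrite c0 ?mulr0//; apply/negP; rewrite -leNgt ltW.
have W j : \int[leb m]_x ((dx (h k) j x - dx f j x) * c j x) @[k --> \oo] --> 0.
  exact: (weak_dx hL fL (fun k x => @hM k x j) hf (bc j) (@c0 j)).
have E k : \int[leb m]_x \det (gradm (upd u i f) x) =
   - \sum_j \int[leb m]_x ((dx (h k) j x - dx f j x) * c j x).
  have h0 := det_espan ii0 uL us H (sh k).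
  rewrite (Rintegral_det_upd ii0 uL us (hL k)) in h0.
  rewrite (Rintegral_det_upd ii0 uL us fL).
  pose S g := \sum_j \int[leb m]_x (dx g j x * c j x).
  have {}h0 : S (h k) = 0 := h0.
  suff -> : \sum_j \int[leb m]_x ((dx (h k) j x - dx f j x) * c j x) = S (h k) - S f.
    by rewrite h0 sub0r opprK.
  rewrite /S -sumrB; apply: eq_bigr => j _; rewrite -RintegralB//; [|exact: ci|exact: ci].
  by apply: eq_Rintegral => x _; rewrite mulrBl.
have lim0 : (- \sum_j \int[leb m]_x ((dx (h k) j x - dx f j x) * c j x)) @[k --> \oo] --> (0 : R).
  rewrite -[X in _ --> X]oppr0; apply: cvgN.
  rewrite [X in _ --> X](_ : 0 = \sum_(j < m) (0 : R)); last by rewrite big1.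
  by apply: cvg_big => //; exact: add_continuous.
have {}E : (fun k => - \sum_j \int[leb m]_x ((dx (h k) j x - dx f j x) * c j x)) =
    (fun=> \int[leb m]_x \det (gradm (upd u i f) x)) by apply/funext => k; exact: esym (E k).
rewrite E in lim0; apply: (cvg_unique _ _ lim0); first exact: Rhausdorff.
exact: cvg_cst.
Qed.

Lemma det_null u i0 : (forall k, loc_lip (u k)) -> bdd_supp (u i0) ->
  \int[leb m]_x \det (gradm u x) = 0.
Proof.
move=> uL us.
(* Induction on the number of rows not yet known to be exponentials. [det_row_step] reduces a
   general row to all exponentials in its place; row [i0] just leaves [A]. *)
suff H (n : nat) : forall (A : {set 'I_m}) u, #|A| = n -> (forall k, loc_lip (u k)) -> bdd_supp (u i0) ->
    (forall i, i != i0 -> i \notin A -> exists k, u i = expo k) ->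
    \int[leb m]_x \det (gradm u x) = 0.
  by apply: (H _ [set: 'I_m]%SET u erefl uL us) => i _; rewrite inE.
elim: n => [|n IH] A {uL us} u An uL us uE.
  apply: (det_expo (uL i0) us) => i ii0; apply: uE => //.
  by rewrite (cards0_eq An) inE.
have [i iA] : exists i, i \in A by apply/set0Pn; rewrite -card_gt0 An.
have An' : #|(A :\ i)%SET| = n by move: (cardsD1 i A); rewrite An iA add1n => -[].
have [ii0|ii0] := eqVneq i i0.
  apply: (IH (A :\ i)%SET u An' uL us) => k ki; rewrite !inE negb_and negbK.
  by case/orP => [/eqP e|]; [rewrite e ii0 eqxx in ki|exact: uE].
rewrite -(upd_id u i); apply: (det_row_step ii0 uL us (uL i)) => k.
apply: (IH (A :\ i)%SET _ An').
- by move=> l; rewrite /upd; case: ifP => // _; exact: loc_lip_expo.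
- by rewrite /upd eq_sym (negbTE ii0).
move=> l li0; rewrite !inE negb_and negbK /upd; case: eqP => [_ _|_ /=]; first by exists k.
exact: uE.
Qed.

End closedness.

(** * Smooth functions are locally Lipschitz *)

Section smooth_loc_lip.
Context {R : realType} {n : nat}.
Implicit Types (f : 'rV[R]_n -> R) (x v : 'rV[R]_n).

Lemma continuous_bounded f : continuous f ->
  forall r : R, exists M : R, forall x, `|x| <= r -> `|f x| <= M.
Proof.
move=> cf r; pose A := [set x : 'rV[R]_n | `|x| <= r].
have cA : compact A.
  apply: bounded_closed_compact; last exact: closed_norm_le.
  exists r; split; first exact: num_real.
  by move=> M rM x /= /le_trans; apply; exact: ltW.
have cfA : {within A, continuous f} by exact: continuous_subspaceT.
have [M [_ hM]] := compact_bounded (continuous_compact cfA cA).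
exists (M + 1) => x xr; apply: (hM (M + 1)); first by rewrite ltrDl.
by exists x.
Qed.

Lemma derive_line f x v (s : R) : derivable f (s *: v + x) v ->
  is_derive s 1 (fun s : R => f (s *: v + x)) ('D_v f (s *: v + x)).
Proof.
move=> df.
have E : (fun h : R => h^-1 *: (((fun s : R => f (s *: v + x)) \o shift s) (h *: 1) - f (s *: v + x)))
   = (fun h => h^-1 *: ((f \o shift (s *: v + x)) (h *: v) - f (s *: v + x))).
  by apply/funext => h /=; rewrite [h *: 1]mulr1 scalerDl addrA.
by split; [rewrite /derivable E|rewrite /derive E].
Qed.

Lemma derive_dx f x v : differentiable f x -> 'D_v f x = \sum_j v 0 j * dx f j x.
Proof.
move=> df; rewrite deriveE// {1}(row_sum_delta v) linear_sum; apply: eq_bigr => j _.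
by rewrite linearZ /= /dx deriveE.
Qed.

Lemma loc_lip_C1 f : (forall x, differentiable f x) -> (forall j, continuous (dx f j)) -> loc_lip f.
Proof.
move=> df cdf r.
have H j := cid (continuous_bounded (cdf j) r).
pose M := \sum_j `|projT1 (H j)|.
have dM j x : `|x| <= r -> `|dx f j x| <= `|projT1 (H j)|.
  by move=> xr; rewrite (le_trans (projT2 (H j) x xr))// ler_norm.
exists M => x y xr yr.
pose v := x - y; pose g (s : R) := f (s *: v + y).
have dg (s : R) : is_derive s (1 : R) g ('D_v f (s *: v + y)).
  by apply: derive_line; exact: diff_derivable.
have cg : {within `[0, 1], continuous g}.
  apply: continuous_subspaceT => s; apply: differentiable_continuous.
  by apply/derivable1_diffP; have [] := dg s.
have [c c01] := @MVT_segment _ g _ 0 1 ler01 (fun s _ => dg s) cg.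
rewrite /g scale1r scale0r add0r subrK subr0 mulr1 => ->.
have cr : `|c *: v + y| <= r.
  have -> : c *: v + y = c *: x + (1 - c) *: y.
    by rewrite scalerBl scale1r scalerBr -addrA [- _ + _]addrC.
  move: c01; rewrite in_itv/= => /andP[c0 c1].
  rewrite (le_trans (ler_normD _ _))// !normrZ (ger0_norm c0) (@ger0_norm _ (1 - c)) ?subr_ge0//.
  have : (1 - c) * `|y| <= (1 - c) * r by rewrite ler_wpM2l// subr_ge0.
  have : c * `|x| <= c * r by rewrite ler_wpM2l.
  lra.
rewrite derive_dx// (le_trans (ler_norm_sum _ _ _))// mulr_suml ler_sum// => j _.
by rewrite normrM mulrC ler_pM//; [exact: dM|exact: rV_coord_le].
Qed.

Lemma smooth_loc_lip f : smooth f -> loc_lip f.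
Proof.
move=> sf; apply: loc_lip_C1 => [x|j x]; first exact: (sf [::] x).
exact: differentiable_continuous (sf [:: ev R j] x).
Qed.

End smooth_loc_lip.

Section det_bound.
Context {R : realType}.

Lemma det_le k (A : 'M[R]_k) (L : R) : (forall i j, `|A i j| <= L) ->
  `|\det A| <= k`!%:R * L ^+ k.
Proof.
elim: k A => [|k IH] A AL; first by rewrite det_mx00 normr1 mulr1.
rewrite (expand_det_row _ 0) (le_trans (ler_norm_sum _ _ _))//.
apply: (@le_trans _ _ (\sum_(j < k.+1) L * (k`!%:R * L ^+ k))).
  apply: ler_sum => j _; rewrite normrM /cofactor normrM normrX normrN1 expr1n mul1r.
  by apply: ler_pM => //; apply: IH => a b; rewrite !mxE.
rewrite sumr_const card_ord -mulr_natl factS natrM exprS; rewrite le_eqVlt; apply/orP; left.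
by apply/eqP; ring.
Qed.

Lemma cofactor_le k (A : 'M[R]_k) (L : R) i j : (forall i j, `|A i j| <= L) ->
  `|cofactor A i j| <= k.-1`!%:R * L ^+ k.-1.
Proof.
move=> AL; rewrite /cofactor normrM normrX normrN1 expr1n mul1r.
by apply: det_le => a b; rewrite !mxE.
Qed.

End det_bound.

Section iint_ge0.
Context {R : realType}.
Local Open Scope ereal_scope.

(** Here the integral of [g] may be infinite a priori: this is what turns the finiteness in [L1c]
    into integrability of a Borel representative. *)
Lemma iint_negligible_ge0 n (f g : bor R n -> \bar R) :
  measurable_fun setT g -> (forall x, 0 <= g x) ->
  (leb n).-negligible [set x | f x <> g x] ->
  iint f = \int[leb n]_x g x.
Proof.
elim: n f g => [|n IH] f g mg g0 N.
  rewrite /= integral_dirac ?diracT ?mul1e//; apply: contrapT => fg.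
  case: N => B [mB + fgB]; rewrite /= /dirac/= indicE mem_set/=; last exact: fgB.
  by move/eqP; rewrite eqe oner_eq0.
rewrite ge0_integral_lebS//=; apply: negligible_eq_integral.
have [B [mB B0 sub]] := negligible_section N; exists B; split => // x /= xfg.
apply: sub; move=> N1; apply: xfg; apply: IH => //.
by have := measurableT_comp mg (@vcons_measurable R n) => /(@measurable_fun_pair2 _ _ _ _ _ _ _ x).
Qed.

Lemma iint0 n : iint (fun _ : 'rV[R]_n => 0) = 0.
Proof. by elim: n => //= n IH; apply: integral0_eq => x _. Qed.

End iint_ge0.

(** * Weak-* continuity of Jacobians *)

Lemma sum_ord_telescope (V : zmodType) (f : nat -> V) (n : nat) :
  \sum_(k < n) (f k - f k.+1) = f 0%N - f n.
Proof.
elim: n => [|n IH]; first by rewrite big_ord0 subrr.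
by rewrite big_ord_recr/= IH addrA subrK.
Qed.

Section weak_continuity.
Context {R : realType} {n : nat}.
Implicit Types (f g a b : 'rV[R]_n -> R) (u : 'I_n -> 'rV[R]_n -> R) (x : 'rV[R]_n).
Let T := bor R n.

Lemma loc_lip_upd u i f : (forall k, loc_lip (u k)) -> loc_lip f -> forall k, loc_lip (upd u i f k).
Proof. by move=> uL fL k; rewrite /upd; case: ifP. Qed.

(* [det_null] applied to the row [g (a - b)] moves the derivative from [a - b] onto [g]. *)
Lemma det_upd_diff u i a b g : (forall k, loc_lip (u k)) -> loc_lip a -> loc_lip b -> loc_lip g -> bdd_supp g ->
  \int[leb n]_x ((\det (gradm (upd u i a) x) - \det (gradm (upd u i b) x)) * g x) =
  - \int[leb n]_x ((a x - b x) * \sum_j dx g j x * cofactor (gradm u x) i j).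
Proof.
move=> uL aL bL gL sg; have [r gr] := sg.
pose w x := a x - b x.
have wL : loc_lip w by exact: loc_lip_sub.
pose c j x := cofactor (gradm u x) i j.
have bc j : loc_bdd (c j) by exact: loc_bdd_cofactor.
have gwL : loc_lip (fun x => g x * w x) by exact: loc_lip_mul.
have := @det_null R n (upd u i (fun x => g x * w x)) i (loc_lip_upd i uL gwL).
rewrite {1}/upd eqxx => /(_ (bdd_supp_mull _ sg)).
have b1 : loc_bdd (fun x => g x * \sum_j dx w j x * c j x).
  apply: loc_bdd_mul; first exact: loc_lip_loc_bdd.
  by apply: loc_bdd_sum => j; apply: loc_bdd_mul => //; exact: loc_bdd_dx.
have b2 : loc_bdd (fun x => w x * \sum_j dx g j x * c j x).
  apply: loc_bdd_mul; first exact: loc_lip_loc_bdd.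
  by apply: loc_bdd_sum => j; apply: loc_bdd_mul => //; exact: loc_bdd_dx.
have s1 : bdd_supp (fun x => g x * \sum_j dx w j x * c j x) by exact: bdd_supp_mull.
have s2 : bdd_supp (fun x => w x * \sum_j dx g j x * c j x).
  exists r => x xr; rewrite big1 ?mulr0// => j _; by rewrite (dx_out _ gr)// mul0r.
have -> : \int[leb n]_x \det (gradm (upd u i (fun x => g x * w x)) x) =
    \int[leb n]_x (g x * (\sum_j dx w j x * c j x) + w x * (\sum_j dx g j x * c j x)).
  apply: Rintegral_negligible.
  apply: negligibleS (negligible_forall (fun j => dxM j gL wL)) => x /= h.
  apply: contrapT => /forallNP nd; apply: h.
  rewrite det_gradm_upd !mulr_sumr -big_split/=; apply: eq_bigr => j _.
  by have /contrapT -> := nd j; rewrite mulrDl -!mulrA.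
rewrite RintegralD//; [|exact: loc_bdd_integrable|exact: loc_bdd_integrable].
move=> /eqP; rewrite addr_eq0 => /eqP <-.
apply: Rintegral_negligible.
have N := negligible_forall (fun j => negligibleU (loc_lip_derivable_ae (ev _ j) aL) (loc_lip_derivable_ae (ev _ j) bL)).
apply: negligibleS N => x /= h.
apply: contrapT => /forallNP nd; apply: h.
rewrite !det_gradm_upd -sumrB mulrC; congr (_ * _); apply: eq_bigr => j _.
rewrite -mulrBl; congr (_ * _).
have /not_orP[/contrapT da /contrapT db] := nd j.
by rewrite /w /dx (deriveB da db).
Qed.

Lemma det_upd_diff_le u i a b g (r L G d : R) : (forall k, loc_lip (u k)) ->
  loc_lip a -> loc_lip b -> loc_lip g -> (forall x, r < `|x| -> g x = 0) ->
  (forall x k j, `|x| <= r -> `|dx (u k) j x| <= L) ->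
  (forall x j, `|x| <= r -> `|dx g j x| <= G) ->
  (forall x, `|x| <= r -> `|a x - b x| <= d) ->
  `|\int[leb n]_x ((\det (gradm (upd u i a) x) - \det (gradm (upd u i b) x)) * g x)| <=
  d * \int[leb n]_x `|(n%:R * (G * (n.-1`!%:R * L ^+ n.-1))) * \1_[set x : T | `|x : 'rV[R]_n| <= r] x|.
Proof.
move=> uL aL bL gL gr uB gB abB.
have sg : bdd_supp g by exists r.
rewrite det_upd_diff// normrN; apply: le_Rintegral_bound.
- apply: loc_bdd_mul; first by apply: loc_lip_loc_bdd; exact: loc_lip_sub.
  by apply: loc_bdd_sum => j; apply: loc_bdd_mul; [exact: loc_bdd_dx|exact: loc_bdd_cofactor].
- by exists r => x xr; rewrite big1 ?mulr0// => j _; rewrite (dx_out _ gr)// mul0r.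
- exact: integrable_cst_ball.
move=> x; have [xr|xr] := leP `|x| r; last first.
  rewrite big1 ?mulr0 ?normr0; last by move=> j _; rewrite (dx_out _ gr)// mul0r.
  rewrite indicE (_ : x \in _ = false) ?mulr0 ?normr0 ?mulr0//.
  by apply/negP; rewrite inE/= leNgt xr.
rewrite indicE mem_set// mulr1 normrM ler_pM//; first exact: abB.
rewrite (le_trans _ (ler_norm _))// (le_trans (ler_norm_sum _ _ _))//.
rewrite -[X in X%:R * (G * _)]card_ord mulr_natl -sumr_const ler_sum// => j _.
rewrite normrM ler_pM//; first exact: gB.
by apply: cofactor_le => k l; rewrite mxE; exact: uB.
Qed.

End weak_continuity.

Section jacobian_continuity.
Context {R : realType} {N : nat} (T : R) (p : 'I_N -> R -> 'rV[R]_N -> R).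
Hypothesis hT : 0 < T.
Hypothesis pL : forall i, Lip_loc_TX T (p i).

Lemma JacE t x : Jac p t x = \det (gradm (fun i => p i t) x).
Proof. by congr (\det _); apply/matrixP => i j; rewrite !mxE. Qed.

Lemma p_uniform (r : R) : exists2 L : R, 0 <= L & forall i t s x y,
  0 <= t <= T -> 0 <= s <= T -> `|x| <= r -> `|y| <= r ->
  `|p i t x - p i s y| <= L * (`|t - s| + `|x - y|).
Proof.
pose L i := projT1 (cid (pL i r)).
exists (\sum_i `|L i|); first exact: sumr_ge0.
move=> i t s x y tT sT xr yr.
have := projT2 (cid (pL i r)) t s x y tT sT xr yr; rewrite -/(L i) => /le_trans; apply.
rewrite ler_wpM2r ?addr_ge0// (le_trans (ler_norm _))// (bigD1 i)//= lerDl.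
exact: sumr_ge0.
Qed.

Lemma p_loc_lip i t : 0 <= t <= T -> loc_lip (p i t).
Proof.
move=> tT r; have [L _ H] := p_uniform r; exists L => x y xr yr.
by have := H i t t x y tT tT xr yr; rewrite subrr normr0 add0r.
Qed.

Lemma p_dx (r : R) : exists2 L : R, 0 <= L & forall i t j x,
  0 <= t <= T -> `|x| <= r -> `|dx (p i t) j x| <= L.
Proof.
have [L L0 H] := p_uniform (r + 1); exists L => // i t j x tT xr.
apply: (@le_trans _ _ (L * `|ev R j|)).
  apply: (@derive_le _ _ _ (r + 1)) => [y z yr zr|]; last by rewrite (le_lt_trans xr)// ltrDl.
  by have := H i t t y z tT tT yr zr; rewrite subrr normr0 add0r.
by rewrite -[leRHS]mulr1 ler_wpM2l// norm_ev.
Qed.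

Lemma Jac_loc_bdd t : 0 <= t <= T -> loc_bdd (Jac p t).
Proof.
move=> tT; rewrite (_ : Jac p t = fun x => \det (gradm (fun i => p i t) x)).
  by apply: loc_bdd_det_gradm => i; exact: p_loc_lip.
by apply/funext => x; rewrite JacE.
Qed.

Lemma Jac_Linf_loc t : 0 <= t <= T -> Linf_loc (Jac p t).
Proof.
move=> tT; have [mJ JM] := Jac_loc_bdd tT.
have null0 : @nullN R N set0 by apply/nullN_negligible; exact: negligible_set0.
split.
  exists (Jac p t); split.
    by move=> B oB; have := mJ measurableT B (open_measurable oB); rewrite setTI.
  by rewrite (_ : mkset _ = set0)//; apply/seteqP; split => x //=; apply.
move=> r; have [M JMr] := JM r; exists M.
rewrite (_ : mkset _ = set0)//; apply/seteqP; split => x //= [xr].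
by rewrite ltNge JMr.
Qed.

Lemma Jac_diff_le (g : 'rV[R]_N -> R) (r : R) : loc_lip g -> (forall x, r < `|x| -> g x = 0) ->
  exists C : R, forall t s, 0 <= t <= T -> 0 <= s <= T ->
  `|\int[leb N]_x ((Jac p t x - Jac p s x) * g x)| <= C * `|t - s|.
Proof.
move=> gL gr.
have [L L0 HL] := p_uniform r; have [D D0 HD] := p_dx r.
have GH j := cid ((loc_bdd_dx j gL).2 r).
pose G := \sum_j `|projT1 (GH j)|.
have gB x j : `|x| <= r -> `|dx g j x| <= G.
  move=> xr; rewrite (le_trans (projT2 (GH j) x xr))// (le_trans (ler_norm _))//.
  by rewrite /G (bigD1 j)//= lerDl sumr_ge0.
set K := \int[leb N]_x `|(N%:R * (G * (N.-1`!%:R * D ^+ N.-1))) * \1_[set x : bor R N | `|x : 'rV[R]_N| <= r] x|.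
exists (\sum_(k < N) L * K) => t s tT sT.
(* Rows of index below [k] are taken at time [s], the others at time [t]; consecutive [U k] differ
   in one row and their determinants telescope. *)
pose U (k : nat) (i : 'I_N) := if (i < k)%N then p i s else p i t.
have UL k i : loc_lip (U k i) by rewrite /U; case: ifP => _; exact: p_loc_lip.
have UD k x i j : `|x| <= r -> `|dx (U k i) j x| <= D.
  by move=> xr; rewrite /U; case: ifP => _; exact: HD.
have Uk (k : 'I_N) : upd (U k) k (p k t) = U k.
  by apply/funext => i; rewrite /upd /U; case: eqP => [->|//]; rewrite ltnn.
have Uk1 (k : 'I_N) : upd (U k) k (p k s) = U k.+1.
  apply/funext => i; rewrite /upd /U; case: eqP => [->|/eqP ik]; first by rewrite leqnn.
  by rewrite ltnS [in RHS]leq_eqVlt (negbTE (ik : (i != k :> nat))).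
have tele x : Jac p t x - Jac p s x = \sum_(k < N) (\det (gradm (U k) x) - \det (gradm (U k.+1) x)).
  rewrite (sum_ord_telescope (fun k => \det (gradm (U k) x))) !JacE; congr (\det _ - \det _).
  by congr gradm; apply/funext => i; rewrite /U ltn_ord.
have sg : bdd_supp g by exists r.
have iD (k : nat) : (leb N).-integrable setT (EFin \o (fun x => (\det (gradm (U k) x) - \det (gradm (U k.+1) x)) * g x) : bor R N -> \bar R).
  apply: loc_bdd_integrable; last by exists r => x xr; rewrite gr// mulr0.
  apply: loc_bdd_mul; last exact: loc_lip_loc_bdd.
  rewrite (_ : (fun x => _) = fun x => \det (gradm (U k) x) + (-1) * \det (gradm (U k.+1) x)).
    apply: loc_bdd_add; first exact: loc_bdd_det_gradm.
    by apply: loc_bdd_mul; [exact: loc_bdd_cst|exact: loc_bdd_det_gradm].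
  by apply/funext => x; rewrite mulN1r.
under eq_Rintegral do rewrite tele mulr_suml.
rewrite Rintegral_sum; last by move=> k; exact: iD.
rewrite (le_trans (ler_norm_sum _ _ _))// mulr_suml ler_sum// => k _.
have -> : \int[leb N]_x ((\det (gradm (U k) x) - \det (gradm (U k.+1) x)) * g x) =
    \int[leb N]_x ((\det (gradm (upd (U k) k (p k t)) x) - \det (gradm (upd (U k) k (p k s)) x)) * g x).
  by rewrite Uk Uk1.
have abB x : `|x| <= r -> `|p k t x - p k s x| <= L * `|t - s|.
  by move=> xr; have := HL k t s x x tT sT xr xr; rewrite subrr normr0 addr0.
rewrite mulrAC.
exact: (@det_upd_diff_le _ _ (U k) k (p k t) (p k s) g r D G (L * `|t - s|) (UL k)
  (p_loc_lip _ tT) (p_loc_lip _ sT) gL gr (fun x i j => @UD k x i j) gB abB).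
Qed.

End jacobian_continuity.

Section weak_star_continuity.
Context {R : realType} {n : nat}.
Let T := bor R n.

Lemma Borel_fun_measurable (g : 'rV[R]_n -> R) : Borel_fun g ->
  measurable_fun setT (g : T -> R).
Proof.
move=> bg; refine (@measurability _ _ T (measurableTypeR R) setT g _ (RGenOpens.measurableE R) _).
by move=> _ [_ [a [b ->]] <-]; rewrite setTI; apply: bg.
Qed.

Lemma loc_bdd_mul_integrable (f g : 'rV[R]_n -> R) (r : R) : loc_bdd f ->
  (leb n).-integrable setT (EFin \o g : T -> \bar R) -> (forall x, r < `|x| -> g x = 0) ->
  (leb n).-integrable setT (EFin \o (fun x => f x * g x) : T -> \bar R).
Proof.
move=> [mf fM] gi gr; have [M fr] := fM r; have [mg _] := integrableP _ _ _ gi.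
apply: le_integrable (integrableZl measurableT M gi) => //.
  by apply/measurable_EFinP; apply: measurable_funM => //; exact/measurable_EFinP.
move=> x _ /=; rewrite lee_fin !normrM; have [xr|xr] := leP `|x| r.
  by rewrite ler_wpM2r// (le_trans (fr x xr))// ler_norm.
by rewrite gr// normr0 !mulr0.
Qed.

Lemma L1c_repr (psi : 'rV[R]_n -> R) : L1c psi -> exists g, exists r : R,
  [/\ (leb n).-integrable setT (EFin \o g : T -> \bar R),
      forall x, r < `|x| -> g x = 0 &
      (leb n).-negligible ([set x | psi x <> g x] : set T)].
Proof.
move=> [[g [bg gpsi]] [r psir] psi1].
pose B : set T := [set x : T | `|x : 'rV[R]_n| <= r].
have mB : measurable B by exact: measurable_norm_le.
pose g' x := g x * \1_B x.
have mg' : measurable_fun setT (g' : T -> R).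
  by apply: measurable_funM; [exact: Borel_fun_measurable|exact: measurable_indic].
have gr x : r < `|x| -> g' x = 0.
  move=> xr; rewrite /g' indicE (_ : x \in B = false) ?mulr0//.
  by apply/negP; rewrite inE/B/= leNgt xr.
have N : (leb n).-negligible ([set x | psi x <> g' x] : set T).
  move/nullN_negligible: gpsi; apply: negligibleS => x /= h e; apply: h.
  have [xr|xr] := leP `|x| r; last by rewrite gr// psir.
  by rewrite e /g' indicE mem_set// mulr1.
exists g', r; split => //.
apply/integrableP; split; first exact/measurable_EFinP.
rewrite -(@iint_negligible_ge0 _ _ (fun x => (`|psi x|)%:E))//.
- by do 2 apply: measurableT_comp => //.
- by apply: negligibleS N => x /= h e; apply: h; rewrite e.
Qed.

End weak_star_continuity.

Section Jac_Cw.
Context {R : realType} {N : nat} (T : R) (p : 'I_N -> R -> 'rV[R]_N -> R).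
Hypothesis pL : forall i, Lip_loc_TX T (p i).

Lemma Jac_Cw : Cw_Linf_loc T (Jac p).
Proof.
split; first exact: Jac_Linf_loc.
move=> psi /L1c_repr[g [r [gi gr Npsi]]].
pose Phi t := \int[leb N]_x (Jac p t x * g x).
have Ji t : 0 <= t <= T -> (leb N).-integrable setT (EFin \o (fun x => Jac p t x * g x) : bor R N -> \bar R).
  by move=> tT; apply: (loc_bdd_mul_integrable _ gi gr); exact: Jac_loc_bdd.
have PhiE t : 0 <= t <= T -> fine (iint (fun x => (Jac p t x * psi x)%:E)) = Phi t.
  move=> tT; congr fine; apply: (@iint_negligible _ _ _ (EFin \o (fun x => Jac p t x * g x))).
    exact: Ji.
  by apply: negligibleS Npsi => x /= h e; apply: h; rewrite e.
apply/subspace_continuousP => t0 /=; rewrite in_itv/= => t0T.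
(* Set to 0 for times outside [0, T], so that the measurability and bounds asked by [weak_limit]
   hold for every [t]. *)
pose f t x := if 0 <= t <= T then Jac p t x - Jac p t0 x else 0.
pose F := within `[0, T]%classic (nbhs t0).
have FF : ProperFilter F.
  by apply: within_nbhs_proper; apply: subset_closure; rewrite /= in_itv.
(* [weak_limit] wants vanishing off an open ball, while [g] is only known to vanish where the norm
   exceeds [r]; hence a strictly larger radius. *)
pose r' := `|r| + 1.
have rr' : r < r' by rewrite (le_lt_trans (ler_norm _))// ltrDl.
have [D D0 HD] := p_dx pL r'.
have W : \int[leb N]_x (f t x * g x) @[t --> F] --> 0.
  apply: (@weak_limit _ _ _ F _ f (N`!%:R * D ^+ N + N`!%:R * D ^+ N) r') => //.
  - move=> t; have [tT|/negbTE tT] := boolP (0 <= t <= T); last first.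
      rewrite (_ : f t = fun=> 0); first exact: measurable_cst.
      by apply/funext => x; rewrite /f tT.
    rewrite (_ : f t = fun x => Jac p t x - Jac p t0 x).
      by apply: measurable_funB; [exact: (Jac_loc_bdd pL tT).1|exact: (Jac_loc_bdd pL t0T).1].
    by apply/funext => x; rewrite /f tT.
  - move=> t x xr; rewrite /f; case: ifP => tT; last first.
      by rewrite normr0 addr_ge0// mulr_ge0// exprn_ge0.
    rewrite (le_trans (ler_normB _ _))// !JacE lerD//; apply: det_le => i j; rewrite mxE;
      by apply: HD => //; exact: ltW.
  - move=> h hL h0.
    have hr x : r' < `|x| -> h x = 0.
      by move=> xr; apply: h0 => /=; apply/negP; rewrite -leNgt ltW.
    have [C HC] := Jac_diff_le pL hL hr.
    have bd t : `|\int[leb N]_x (f t x * h x)| <= `|C| * `|t - t0|.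
      have [tT|/negbTE tT] := boolP (0 <= t <= T).
        under eq_Rintegral do rewrite /f tT.
        by rewrite (le_trans (HC t t0 tT t0T))// ler_wpM2r// ler_norm.
      rewrite (_ : Rintegral _ _ _ = 0) ?normr0 ?mulr_ge0//.
      by rewrite /Rintegral integral0_eq// => x _; rewrite /f tT mul0r.
    have H : \int[leb N]_x (f t x * h x) @[t --> t0] --> 0.
      apply/cvgrPdist_le => e e0; near=> t; rewrite sub0r normrN (le_trans (bd t))//.
      apply: (@le_trans _ _ ((`|C| + 1) * `|t - t0|)); first by rewrite ler_wpM2r// lerDl.
      rewrite mulrC -ler_pdivlMr ?ltr_wpDl// distrC; near: t.
      by apply: cvgr_dist_le; [exact: cvg_id|rewrite divr_gt0// ltr_wpDl].
    apply: cvg_trans H; apply: cvg_app; exact: cvg_within.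
  - by move=> x xr; apply: gr; rewrite (lt_le_trans rr')// leNgt; exact/negP.
have W2 : Phi t0 + \int[leb N]_x (f t x * g x) @[t --> F] -->
    fine (iint (fun x => (Jac p t0 x * psi x)%:E)).
  rewrite PhiE// -[X in _ --> X]addr0; by apply: cvgD => //; exact: cvg_cst.
apply: cvg_trans W2; apply: near_eq_cvg; near=> t.
have : `[0, T]%classic t by near: t; exact: withinT.
rewrite /= in_itv/= => tT; rewrite [RHS](PhiE t tT) /Phi -RintegralD//; [|exact: Ji|].
  by apply: eq_Rintegral => x _; rewrite /f tT; ring.
rewrite (_ : _ \o _ = (fun x => (Jac p t x * g x)%:E - (Jac p t0 x * g x)%:E)%E).
  by apply: integrableB => //; exact: Ji.
by apply/funext => x /=; rewrite /f tT mulrBl.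
Unshelve. all: by end_near. Qed.

End Jac_Cw.

(** * The transport equation *)

Section spacetime.
Context {R : realType} {N : nat}.
Implicit Types (z w : 'rV[R]_(1 + N)) (x : 'rV[R]_N).

Lemma vhdB_le z w : `|vhd z - vhd w| <= `|z - w|.
Proof.
have := lexx `|z - w|.
by rewrite -{1}(vconsK z) -{1}(vconsK w) vconsN vconsD vcons_norm_le => /andP[].
Qed.

Lemma vtlB_le z w : `|vtl z - vtl w| <= `|z - w|.
Proof.
have := lexx `|z - w|.
by rewrite -{1}(vconsK z) -{1}(vconsK w) vconsN vconsD vcons_norm_le => /andP[].
Qed.

Lemma ev_lshift : ev R (lshift N (0 : 'I_1)) = vcons 1 (0 : 'rV[R]_N).
Proof.
apply/rowP => k; rewrite mxE eqxx/=; case: (split_ordP k) => j ->.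
  by rewrite ord1 vcons0 eqxx.
by rewrite vconsS mxE; case: eqP => // /eqP; rewrite eq_rlshift.
Qed.

Lemma ev_rshift (j : 'I_N) : ev R (rshift 1 j) = vcons 0 (ev R j).
Proof.
apply/rowP => k; rewrite mxE eqxx/=; case: (split_ordP k) => i ->.
  by rewrite ord1 vcons0; case: eqP => // /eqP; rewrite eq_lrshift.
by rewrite vconsS mxE eqxx eq_rshift.
Qed.

Lemma vconsZ (h t : R) x : h *: vcons t x = vcons (h * t) (h *: x).
Proof. by rewrite /vcons scale_row_mx scale_scalar_mx. Qed.

Lemma dx_time (q : R -> 'rV[R]_N -> R) z :
  dx (fun z => q (vhd z) (vtl z)) (lshift N 0) z = dt q (vhd z) (vtl z).
Proof.
have E : (fun h : R => h^-1 *: (((fun z => q (vhd z) (vtl z)) \o shift z) (h *: ev R (lshift N 0)) - q (vhd z) (vtl z)))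
    = (fun h => h^-1 *: (q (h + vhd z) (vtl z) - q (vhd z) (vtl z))).
  apply/funext => h /=.
  by rewrite ev_lshift -{1 2}(vconsK z) vconsZ vconsD !vhdK !vtlK mulr1 scaler0 add0r.
by rewrite /dx /dt /derive /derive1 E.
Qed.

Lemma dx_space (q : R -> 'rV[R]_N -> R) j z :
  dx (fun z => q (vhd z) (vtl z)) (rshift 1 j) z = dx (q (vhd z)) j (vtl z).
Proof.
have E : (fun h : R => h^-1 *: (((fun z => q (vhd z) (vtl z)) \o shift z) (h *: ev R (rshift 1 j)) - q (vhd z) (vtl z)))
    = (fun h => h^-1 *: ((q (vhd z) \o shift (vtl z)) (h *: ev R j) - q (vhd z) (vtl z))).
  apply/funext => h /=.
  by rewrite ev_rshift -{1 2}(vconsK z) vconsZ vconsD !vhdK !vtlK mulr0 add0r.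
by rewrite /dx /derive E.
Qed.

Lemma open_vhd_lt (c : R) : open [set z : 'rV[R]_(1 + N) | vhd z < c].
Proof.
have -> : [set z : 'rV[R]_(1 + N) | vhd z < c] = (@vhd R N) @^-1` [set y : R | y < c] by [].
by apply: open_comp; [move=> z _; exact: vhd_continuous|exact: open_lt].
Qed.

Lemma open_vhd_gt (c : R) : open [set z : 'rV[R]_(1 + N) | c < vhd z].
Proof.
have -> : [set z : 'rV[R]_(1 + N) | c < vhd z] = (@vhd R N) @^-1` [set y : R | c < y] by [].
by apply: open_comp; [move=> z _; exact: vhd_continuous|exact: open_gt].
Qed.

Lemma vtl_norm_continuous : continuous (fun z : 'rV[R]_(1 + N) => `|vtl z|).
Proof.
by move=> z; exact: (continuous_comp (@vtl_continuous R N z) (@norm_continuous _ _ (vtl z))).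
Qed.

Lemma open_vtl_lt (c : R) : open [set z : 'rV[R]_(1 + N) | `|vtl z| < c].
Proof.
have -> : [set z : 'rV[R]_(1 + N) | `|vtl z| < c] = (fun z : 'rV[R]_(1 + N) => `|vtl z|) @^-1` [set y : R | y < c] by [].
by apply: open_comp; [move=> z _; exact: vtl_norm_continuous|exact: open_lt].
Qed.

Lemma open_vtl_gt (c : R) : open [set z : 'rV[R]_(1 + N) | c < `|vtl z|].
Proof.
have -> : [set z : 'rV[R]_(1 + N) | c < `|vtl z|] = (fun z : 'rV[R]_(1 + N) => `|vtl z|) @^-1` [set y : R | c < y] by [].
by apply: open_comp; [move=> z _; exact: vtl_norm_continuous|exact: open_gt].
Qed.

Lemma dx_open_eq (f g : 'rV[R]_(1 + N) -> R) (U : set 'rV[R]_(1 + N)) k z :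
  open U -> U z -> (forall w, U w -> f w = g w) -> dx f k z = dx g k z.
Proof.
move=> oU Uz fg; apply: near_eq_derive.
by apply: filterS (open_nbhs_nbhs (conj oU Uz)) => w; exact: fg.
Qed.

Lemma det_transport (At : R) (B a : 'rV[R]_N) (C : 'cV[R]_N) (D : 'M[R]_N) :
  C + D *m a^T = 0 ->
  \det (block_mx (At%:M : 'M[R]_1) B C D) = (At + \sum_j a 0 j * B 0 j) * \det D.
Proof.
move=> CD0.
pose E : 'M[R]_(1 + N) := block_mx 1%:M 0 a^T 1%:M.
have detE : \det E = 1 by rewrite /E det_lblock !det1 mulr1.
rewrite -[LHS]mulr1 -detE -det_mulmx /E mulmx_block !mulmx1 !mulmx0 !add0r CD0.
rewrite det_ublock; congr (_ * _).
rewrite det_mx11 !mxE eqxx mulr1n; congr (_ + _); apply: eq_bigr => j _.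
by rewrite mxE mulrC.
Qed.

End spacetime.

Section weak_solution.
Context {R : realType} {N : nat} (T : R) (a : R -> 'rV[R]_N -> 'rV[R]_N)
  (p : 'I_N -> R -> 'rV[R]_N -> R).
Hypothesis hT : 0 < T.
Hypothesis pL : forall i, Lip_loc_TX T (p i).
Hypothesis hp : forall i, nullTX [set z : R * 'rV[R]_N | 0 < z.1 < T /\
        dt (p i) z.1 z.2 + adotgrad (a z.1 z.2) (grad (p i z.1) z.2) <> 0].

Definition clampv (rho : R) (x : 'rV[R]_N) : 'rV[R]_N :=
  \row_j Num.max (- rho) (Num.min (x 0 j) rho).

(** [det_null] needs rows that are locally Lipschitz on all of R^(1+N). The values altered by
    clamping lie where the row of the test function has zero gradient. *)
Definition pclamp (rho : R) (i : 'I_N) (z : 'rV[R]_(1 + N)) : R :=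
  p i (Num.max 0 (Num.min (vhd z) T)) (clampv rho (vtl z)).

Lemma clampv_le rho x : 0 <= rho -> `|clampv rho x| <= rho.
Proof.
move=> r0; have r0' : - rho <= rho by rewrite (le_trans _ r0)// oppr_le0.
apply: rV_norm_leI => // j; rewrite mxE ler_norml le_max lexx/= ge_max r0'/=.
by rewrite ge_min lexx orbT.
Qed.

Lemma pclamp_loc_lip rho i : 0 <= rho -> loc_lip (pclamp rho i).
Proof.
move=> r0 s; have [L L0 H] := p_uniform pL rho.
have clT t : 0 <= Num.max 0 (Num.min t T) <= T.
  by rewrite le_max lexx/= ge_max (ltW hT)/= ge_min lexx orbT.
exists (L + L) => z w _ _.
rewrite (le_trans (H i _ _ _ _ (clT _) (clT _) (clampv_le _ r0) (clampv_le _ r0)))//.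
rewrite mulrDr mulrDl lerD// ler_wpM2l//.
  by rewrite (le_trans (clamp_lip _ _ _ _))// vhdB_le.
apply: (le_trans _ (vtlB_le z w)); apply: rV_norm_leI => // j; rewrite !mxE.
rewrite (le_trans (clamp_lip _ _ _ _))//.
by have := rV_coord_le (vtl z - vtl w) j; rewrite !mxE.
Qed.

Lemma pclampE rho i z : 0 <= vhd z <= T -> `|vtl z| <= rho ->
  pclamp rho i z = p i (vhd z) (vtl z).
Proof.
move=> /andP[z0 zT] zr; rewrite /pclamp min_l// max_r//; congr p.
apply/rowP => j; rewrite mxE.
have := le_trans (rV_coord_le (vtl z) j) zr; rewrite ler_norml => /andP[h1 h2].
by rewrite min_l// max_r.
Qed.

Lemma weak_sol_Jac : weak_sol T a (Jac p).
Proof.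
move=> phi [sphi [e [r [e0 eT phi0]]]].
pose Phi (z : 'rV[R]_(1 + N)) := phi (vhd z) (vtl z).
(* Strictly beyond [r], so that around every point over the support of the test function [pclamp]
   and [p i] agree on an open set and have the same derivatives. *)
pose rho := `|r| + 1.
have rho0 : 0 <= rho by rewrite addr_ge0.
have rrho : r < rho by rewrite (le_lt_trans (ler_norm _))// ltrDl.
have PhiL : loc_lip Phi by exact: smooth_loc_lip.
have PhiS : bdd_supp Phi.
  exists (Num.max T `|r|) => z; rewrite -[z]vconsK => zr.
  rewrite /Phi vhdK vtlK; apply/eqP; apply/negPn/negP => /eqP /phi0[/andP[h1 h2] h3].
  move: zr; rewrite ltNge => /negP; apply; rewrite vcons_norm_le; apply/andP; split.
    by rewrite le_max; apply/orP; left; rewrite ler_norml; apply/andP; split; lra.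
  by rewrite le_max (le_trans h3 (ler_norm _)) orbT.
pose u (k : 'I_(1 + N)) : 'rV[R]_(1 + N) -> R := match fintype.split k with inl _ => Phi | inr i => pclamp rho i end.
have u0 : u (lshift N 0) = Phi by rewrite /u (unsplitK (inl _)).
have uS i : u (rshift 1 i) = pclamp rho i by rewrite /u (unsplitK (inr _)).
have uL (k : 'I_(1 + N)) : loc_lip (u k).
  by case: (split_ordP k) => i ->; rewrite ?ord1 ?u0 ?uS//; exact: pclamp_loc_lip.
(* The conditions are strict, so [Phi] vanishes in a neighbourhood of [z]; there both integrands are
   0 whatever [a] and the clamped rows are. *)
have out z : vhd z < e \/ T - e < vhd z \/ r < `|vtl z| -> forall k, dx Phi k z = 0.
  have zero U k : open U -> U z -> (forall w, U w -> Phi w = 0) -> dx Phi k z = 0.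
    by move=> oU Uz U0; rewrite (dx_open_eq _ oU Uz (g := fun=> 0) U0) /dx derive_cst.
  have nz w : (vhd w < e \/ T - e < vhd w \/ r < `|vtl w|) -> Phi w = 0.
    move=> h; apply/eqP; apply/negPn/negP => /eqP /phi0[/andP[h1 h2] h3].
    by case: h => [|[]]; rewrite ltNge ?h1 ?h2 ?h3.
  move=> [h|[h|h]] k.
  - exact: (zero _ k (@open_vhd_lt _ _ e) h (fun w hw => nz w (or_introl hw))).
  - exact: (zero _ k (@open_vhd_gt _ _ (T - e)) h (fun w hw => nz w (or_intror (or_introl hw)))).
  - exact: (zero _ k (@open_vtl_gt _ _ r) h (fun w hw => nz w (or_intror (or_intror hw)))).
have out_det z : (forall k, dx Phi k z = 0) -> \det (gradm u z) = 0.
  by move=> h; apply: (@det_row0 _ _ _ (lshift N 0)) => k; rewrite mxE u0.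
pose W (t : R) (x : 'rV[R]_N) := Jac p t x * (dt phi t x + adotgrad (a t x) (grad (phi t) x)).
(* Extension by zero in time turns the integral over (0, T) into [iint] on R^(1+N), to which the
   comparison up to null sets applies. *)
pose F (z : bor R N.+1) : \bar R := if (0 < @vhd R N z < T) then (W (vhd z) (vtl z))%:E else 0%E.
have out_W z : (forall k, dx Phi k z = 0) -> W (vhd z) (vtl z) = 0.
  move=> h; have := h (lshift N 0); rewrite dx_time /W => ->.
  rewrite /adotgrad big1 ?addr0 ?mulr0// => j _.
  by have := h (rshift 1 j); rewrite dx_space mxE => ->; rewrite mulr0.
have inside z : 0 < vhd z < T -> `|vtl z| < rho ->
    (forall i, dt (p i) (vhd z) (vtl z) + adotgrad (a (vhd z) (vtl z)) (grad (p i (vhd z)) (vtl z)) = 0) ->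
    W (vhd z) (vtl z) = \det (gradm u z).
  move=> zT zr pde.
  pose U := [set w : 'rV[R]_(1 + N) | 0 < vhd w] `&` [set w : 'rV[R]_(1 + N) | vhd w < T] `&` [set w : 'rV[R]_(1 + N) | `|vtl w| < rho].
  have oU : open U.
    apply: openI; last exact: open_vtl_lt.
    by apply: openI; [exact: open_vhd_gt|exact: open_vhd_lt].
  have Uz : U z by move/andP: zT => [? ?].
  have PU i w : U w -> pclamp rho i w = p i (vhd w) (vtl w).
    by move=> [[w0 wT] wr]; apply: pclampE; [apply/andP; split; exact: ltW|exact: ltW].
  have dP i k : dx (pclamp rho i) k z = dx (fun w => p i (vhd w) (vtl w)) k z.
    exact: (dx_open_eq k oU Uz (PU i)).
  pose D : 'M[R]_N := \matrix_(i, j) dx (p i (vhd z)) j (vtl z).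
  have -> : gradm u z = block_mx ((dt phi (vhd z) (vtl z))%:M : 'M[R]_1) (grad (phi (vhd z)) (vtl z))
      (\col_i dt (p i) (vhd z) (vtl z)) D.
    apply/matrixP => k l; rewrite mxE.
    case: (split_ordP k) => i ->; case: (split_ordP l) => j ->.
    - by rewrite block_mxEul !ord1 u0 [in LHS]dx_time mxE eqxx mulr1n.
    - by rewrite block_mxEur !ord1 u0 [in LHS]dx_space mxE.
    - by rewrite block_mxEdl !ord1 uS dP dx_time mxE.
    - by rewrite block_mxEdr uS dP dx_space mxE.
  (* [pde] says that the time column below its first entry is the opposite of [D] applied to [a]. *)
  rewrite (@det_transport _ _ _ _ (a (vhd z) (vtl z))).
    by rewrite /W mulrC JacE (_ : gradm _ _ = D)//.
  apply/colP => i; rewrite !mxE -[RHS](pde i); congr (_ + _).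
  by apply: eq_bigr => j _; rewrite !mxE mulrC.
have di : (leb N.+1).-integrable setT (EFin \o (fun z => \det (gradm u z)) : bor R N.+1 -> \bar R).
  apply: loc_bdd_integrable; first exact: loc_bdd_det_gradm.
  have [s Ps] := PhiS; exists s => z zs.
  by apply: (@det_gradm_out _ _ u (lshift N 0) s) => // w; rewrite u0; exact: Ps.
(* Outside (0, T) and for large [|vtl z|] both sides are 0; elsewhere [inside] applies off the
   finite union of the null sets where some transport equation fails. *)
have NF : (leb N.+1).-negligible [set z : bor R N.+1 | F z <> (\det (gradm u z))%:E].
  have Nh := negligible_forall (fun i => nullTX_negligible (hp i)).
  apply: negligibleS Nh => z /= FN; apply: contrapT => /forallNP good; apply: FN.
  rewrite /F; have [zT|zT] := boolP (0 < @vhd R N z < T); last first.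
    rewrite out_det//; apply: out; move: zT; rewrite negb_and -!leNgt => /orP[z0|z0].
      by left; exact: le_lt_trans e0.
    by right; left; lra.
  have [zr|zr] := ltP `|@vtl R N z| rho.
    congr EFin; apply: inside => // i; apply: contrapT => ne; exact: (good i).
  have Z : forall k, dx Phi k z = 0 by apply: out; right; right; exact: lt_le_trans zr.
  by rewrite out_W// out_det.
have key : iint F = 0%E.
  rewrite (iint_negligible di NF).
  have us : bdd_supp (u (lshift N 0)) by rewrite u0.
  have := det_null uL us; rewrite /Rintegral => d0.
  by rewrite -(fineK (integrable_fin_num measurableT di)) d0.
rewrite -[RHS]key /= integral_mkcond; apply: eq_integral => t _.
rewrite patchE /Defs.openT; case: ifPn => tT.
  have {}tT : 0 < t < T by move: tT; rewrite inE/= in_itv.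
  congr iint; apply/funext => x; rewrite /F -/(vcons t x) vhdK vtlK tT//.
rewrite -[LHS](@iint0 R N); congr iint; apply/funext => x; rewrite /F -/(vcons t x) vhdK.
case: ifPn => // tT'; move/negP: tT; case; by rewrite inE/= in_itv.
Qed.

End weak_solution.

Theorem mainTheorem4 (R : realType) (N : nat) (T : R) (hT : 0 < T)
    (a : R -> 'rV[R]_N -> 'rV[R]_N) (p : 'I_N -> R -> 'rV[R]_N -> R) :
  Linf_TX T a ->
  (forall i, Lip_loc_TX T (p i)) ->
  (forall i, nullTX [set z : R * 'rV[R]_N | 0 < z.1 < T /\
        dt (p i) z.1 z.2 + adotgrad (a z.1 z.2) (grad (p i z.1) z.2) <> 0]) ->
  WT T a (Jac p).
Proof. by move=> _ pL hp; split; [exact: Jac_Cw|exact: weak_sol_Jac]. Qed.
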